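(* Let $p>2$ and let $\gamma:[0,L]\to\mathbb{R}^d$ be an arclength parametrized $C^1([0,L];\mathbb{R}^d)$ curve with length $L>0$ and $R(\gamma)\le M$ for a constant $M>0$. Then $\gamma\in W^{2-\frac1p,p}([0,L];\mathbb{R}^d)$, its image is an embedded one dimensional submanifold of $\mathbb{R}^d$ with boundary, and $$[\gamma']^p_{W^{1-\frac1p,p}([0,L];\mathbb{R}^d)}\le C(p,M)$$ for a constant $C(p,M)>0$ only depending on $p$ and $M$ and in particular independent of $\gamma$.
   Context: For a $C^1$ curve $\gamma$ on $[0,L]$ with image $\Gamma$, $$R(\gamma)=2^{-p}E^p_{\rm tp}(\gamma)-\log|\gamma(0)-\gamma(L)|+\int_0^L|\gamma'(t)|\,dt,\qquad E^p_{\rm tp}(\gamma)=\int_0^L\!\!\int_0^L\frac{|\gamma'(s)||\gamma'(t)|}{r^\gamma_{\rm tp}(\gamma(s),\gamma(t))^p}\,ds\,dt,$$ with $-\log0=+\infty$. Here $r^\gamma_{\rm tp}(x,y)$ is the radius of the unique circle tangent to $\Gamma$ at $x$ and passing through $x$ and $y$, i.e. $r^\gamma_{\rm tp}(\gamma(s),\gamma(t))=\frac{|\gamma(s)-\gamma(t)|^2}{2\,{\rm dist}(\gamma(s)-\gamma(t),\mathbb{R}\gamma'(s))}$; it is set to $0$ if $x=y$ and to $+\infty$ if $x-y\neq0$ is parallel to the tangent at $x$. Sobolev–Slobodeckij spaces: for $\sigma\in(0,1)$ and an interval $U$, $[f]^p_{W^{\sigma,p}(U)}=\int_U\int_U\frac{|f(x)-f(y)|^p}{|x-y|^{1+\sigma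 p}}\,dx\,dy$; $W^{1+\sigma,p}(U)$ is the set of $f\in W^{1,p}(U)$ with $f'\in L^p(U)$ and $[f']_{W^{\sigma,p}(U)}<\infty$ (componentwise for vector-valued maps). In particular $[\gamma']^p_{W^{1-1/p,p}([0,L])}=\int_0^L\int_0^L\frac{|\gamma'(s)-\gamma'(t)|^p}{|s-t|^p}\,ds\,dt$. *)

(* Defs.v *)
From mathcomp Require Export all_boot all_order all_algebra.
From mathcomp Require Export all_classical all_reals all_analysis.
Export Order.TTheory GRing.Theory Num.Theory.
Export numFieldNormedType.Exports.

Set Implicit Arguments.
Unset Strict Implicit.
Unset Printing Implicit Defensive.

Local Open Scope classical_set_scope.
Local Open Scope ring_scope.

(* The library norm on 'rV[R]_d is the sup norm; the Euclidean one induces the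
   same topology, so limits and continuity in 'rV[R]_d can use the library's. *)
Definition enorm (R : realType) (d : nat) (v : 'rV[R]_d) : R :=
  Num.sqrt (\sum_(i < d) v ord0 i ^+ 2).

Definition dist_line (R : realType) (d : nat) (v w : 'rV[R]_d) : R :=
  inf [set enorm (v - k *: w) | k in [set: R]].

(* Limits are taken inside A, so at an endpoint of an interval A these are
   one-sided; the values of f outside A play no role. *)
Definition difference_quotient (R : realType) (d : nat)
    (f : R -> 'rV[R]_d) (t u : R) : 'rV[R]_d :=
  (u - t)^-1 *: (f u - f t).

Definition derivable_within (R : realType) (d : nat) (A : set R)
    (f : R -> 'rV[R]_d) (t : R) : Prop :=
  cvg (difference_quotient f t u @[u --> within A (dnbhs t)]).

Definition derive_within (R : realType) (d : nat) (A : set R)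
    (f : R -> 'rV[R]_d) (t : R) : 'rV[R]_d :=
  lim (difference_quotient f t u @[u --> within A (dnbhs t)]).

Definition C1_on (R : realType) (d : nat) (A : set R) (f : R -> 'rV[R]_d) :
    Prop :=
  (forall t, A t -> derivable_within A f t) /\
  {within A, continuous (derive_within A f)}.

Definition arclength_param (R : realType) (d : nat) (L : R)
    (gamma : R -> 'rV[R]_d) : Prop :=
  forall t, t \in `[0, L] -> enorm (derive_within `[0, L] gamma t) = 1.

(* r_tp(gamma(s), gamma(t)), the tangent at gamma(s) being spanned by
   gamma'(s). *)
Definition rtp (R : realType) (d : nat) (L : R) (gamma : R -> 'rV[R]_d)
    (s t : R) : \bar R :=
  let v := gamma s - gamma t in
  let w := derive_within `[0, L] gamma s in
  if v == 0 then 0%E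
  else if `[< exists k : R, v = k *: w >] then +oo%E
  else (enorm v ^+ 2 / (2 * dist_line v w))%:E.

(* In \bar R, 0^-1 = +oo and +oo^-1 = 0. *)
Definition Etp (R : realType) (d : nat) (p L : R) (gamma : R -> 'rV[R]_d) :
    \bar R :=
  (\int[lebesgue_measure]_(t in `[0%R, L])
   \int[lebesgue_measure]_(s in `[0%R, L])
     ((enorm (derive_within `[0%R, L] gamma s) *
       enorm (derive_within `[0%R, L] gamma t))%R%:E
      * (rtp L gamma s t `^ p)^-1))%E.

(* lne 0 = -oo. *)
Definition energyR (R : realType) (d : nat) (p L : R) (gamma : R -> 'rV[R]_d) :
    \bar R :=
  ((2 `^ (- p))%R%:E * Etp p L gamma
   - lne (enorm (gamma 0%R - gamma L))%:E
   + \int[lebesgue_measure]_(t in `[0%R, L])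
       (enorm (derive_within `[0%R, L] gamma t))%:E)%E.

Definition test_function (R : realType) (a b : R) (phi : R -> R) : Prop :=
  [/\ forall (n : nat) (x : R), derivable (derive1n n phi) x 1,
      compact (closure [set x | phi x != 0]) &
      closure [set x | phi x != 0] `<=` `]a, b[ ].

Definition weak_derivative (R : realType) (a b : R) (f g : R -> R) : Prop :=
  forall phi : R -> R, test_function a b phi ->
    \int[lebesgue_measure]_(x in `[a, b]) (f x * derive1 phi x) =
    - \int[lebesgue_measure]_(x in `[a, b]) (g x * phi x).

Definition Lp_on (R : realType) (p a b : R) (f : R -> R) : Prop :=
  f \_ `[a, b] \in Lfun (@lebesgue_measure R) p%:E.

(* The p-th power of the seminorm, for functions valued in an abelian group V
   normed by N. On the diagonal the integrand is a junk value, harmless since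
   the diagonal is a null set. *)
Definition slobodeckij_pow (R : realType) (V : zmodType) (N : V -> R)
    (sigma p a b : R) (f : R -> V) : \bar R :=
  (\int[lebesgue_measure]_(y in `[a, b])
   \int[lebesgue_measure]_(x in `[a, b])
     (N (f x - f y)%R `^ p / `|x - y| `^ (1 + sigma * p))%R%:E)%E.

(* Membership in W^{1+sigma,p}([a,b]), for scalar functions. *)
Definition in_W1 (R : realType) (sigma p a b : R) (f : R -> R) : Prop :=
  exists g : R -> R,
    [/\ Lp_on p a b f, weak_derivative a b f g, Lp_on p a b g &
        (slobodeckij_pow (fun x : R => `|x|%R) sigma p a b g < +oo)%E].

Definition in_W1_vec (R : realType) (d : nat) (sigma p a b : R)
    (f : R -> 'rV[R]_d) : Prop :=
  forall i : 'I_d, in_W1 sigma p a b (fun t => f t ord0 i).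

Definition open_in_halfline (R : realType) (O : set R) : Prop :=
  exists2 V : set R, open V & O = V `&` `[0, +oo[.

(* A one dimensional C^1 submanifold with (possibly empty) boundary: near each
   of its points G is the image of a relatively open subset O of the half-line
   [0, +oo[ under a C^1 immersion psi that is a homeomorphism onto its image
   for the subspace topology; phi is the inverse homeomorphism. Taking O
   inside ]0, +oo[ gives the charts at interior points. *)
Definition embedded_curve_with_boundary (R : realType) (d : nat)
    (G : set 'rV[R]_d) : Prop :=
  forall x, G x ->
  exists2 W : set 'rV[R]_d, open W /\ W x &
  exists (O : set R) (psi : R -> 'rV[R]_d) (phi : 'rV[R]_d -> R),
    [/\ open_in_halfline O,
        C1_on O psi /\ (forall t, O t -> derive_within O psi t != 0),
        set_bij O (G `&` W) psi,
        (forall t, O t -> phi (psi t) = t) &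
        {within G `&` W, continuous phi}].

(* Main.v *)
(* The distance from a chord of length at most [h] to the tangent lines at its two
   ends controls the angle between these tangents, so on an arc along which the
   tangent turns by at most 1 the Slobodeckij integrand is bounded pointwise by
   the symmetrized integrand of the tangent-point energy. The length of such arcs
   is bounded below in terms of [p] and [M]: if the tangent turns by 1/2 within
   length [l], a stopping argument over the dyadic scales (a truncated Morrey
   embedding) yields energy at least [c l ^ (2 - p)]. Farther apart the integrand
   is bounded by a constant, and the logarithmic term bounds [L].

   The curve need not be injective: a circle run one and a half times has finite
   energy, since [r_tp = 0] only on a null set of parameters. However, if two
   parameters have the same image and one of them is interior, then the curve near
   the other runs inside the arc around the interior one: where it leaves this
   arc, the energy at scale [rho] is at least [c rho ^ (2 - p)]. Since
   [gamma 0 != gamma L], this provides the charts. *)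

Require Import Defs.
From mathcomp Require Import measure measurable_realfun lebesgue_integral.
From mathcomp Require Import ring lra.

Set Implicit Arguments.
Unset Strict Implicit.
Unset Printing Implicit Defensive.

Local Open Scope classical_set_scope.
Local Open Scope ring_scope.

(** * Euclidean norm *)

(** The angle estimate is only available where the tangent turns by at most 1, while the modulus of
    continuity of a [C1] tangent depends on the curve. A modulus depending on [p] and [M] alone
    therefore has to come before the seminorm bound, and it exists because [2 < p] makes the
    exponent [1 - 1/p] supercritical on the line, with Hölder exponent [1 - 2/p]. The radius [rtp]
    is defined by cases from an infimum, and its measurability is never established. Additivity and
    Tonelli are applied to [tp_quot], an explicit measurable minorant of the energy density up to
    the factor [2^p]. The energy itself is only bounded from below, by monotonicity of the integral
    or by constants on measurable sets, which is legitimate for any nonnegative integrand. *)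

Definition dotr (R : realType) (d : nat) (u v : 'rV[R]_d) : R :=
  \sum_(i < d) u ord0 i * v ord0 i.

Lemma dotrC (R : realType) (d : nat) (u v : 'rV[R]_d) : dotr u v = dotr v u.
Proof. by apply: eq_bigr => i _; rewrite mulrC. Qed.

Lemma dotrDl (R : realType) (d : nat) (u v w : 'rV[R]_d) :
  dotr (u + v) w = dotr u w + dotr v w.
Proof. by rewrite -big_split; apply: eq_bigr => i _; rewrite mxE mulrDl. Qed.

Lemma dotrZl (R : realType) (d : nat) (k : R) (u w : 'rV[R]_d) :
  dotr (k *: u) w = k * dotr u w.
Proof. by rewrite mulr_sumr; apply: eq_bigr => i _; rewrite mxE mulrA. Qed.

Lemma dotrDr (R : realType) (d : nat) (u v w : 'rV[R]_d) :
  dotr w (u + v) = dotr w u + dotr w v.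
Proof. by rewrite !(dotrC w) dotrDl. Qed.

Lemma dotrZr (R : realType) (d : nat) (k : R) (u w : 'rV[R]_d) :
  dotr w (k *: u) = k * dotr w u.
Proof. by rewrite !(dotrC w) dotrZl. Qed.

Lemma dotrNl (R : realType) (d : nat) (u w : 'rV[R]_d) :
  dotr (- u) w = - dotr u w.
Proof. by rewrite -scaleN1r dotrZl mulN1r. Qed.

Lemma dotrNr (R : realType) (d : nat) (u w : 'rV[R]_d) :
  dotr w (- u) = - dotr w u.
Proof. by rewrite !(dotrC w) dotrNl. Qed.

Definition dotrE := (dotrDl, dotrDr, dotrNl, dotrNr, dotrZl, dotrZr).

Lemma dotr_ge0 (R : realType) (d : nat) (u : 'rV[R]_d) : 0 <= dotr u u.
Proof. by apply: sumr_ge0 => i _; rewrite -expr2 sqr_ge0. Qed.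

Lemma enormE (R : realType) (d : nat) (u : 'rV[R]_d) :
  enorm u = Num.sqrt (dotr u u).
Proof. by congr Num.sqrt; apply: eq_bigr => i _; rewrite expr2. Qed.

Lemma sqr_enorm (R : realType) (d : nat) (u : 'rV[R]_d) :
  enorm u ^+ 2 = dotr u u.
Proof. by rewrite enormE sqr_sqrtr ?dotr_ge0. Qed.

Lemma enorm_ge0 (R : realType) (d : nat) (u : 'rV[R]_d) : 0 <= enorm u.
Proof. exact: sqrtr_ge0. Qed.

(** Cauchy-Schwarz, from the nonnegativity of the squared distance between [u] and its projection on
    [v]. *)
Lemma dotr_le (R : realType) (d : nat) (u v : 'rV[R]_d) :
  dotr u v <= enorm u * enorm v.
Proof.
have h : dotr u v ^+ 2 <= (enorm u * enorm v) ^+ 2.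
  rewrite exprMn !sqr_enorm.
  have [v0|v0] := eqVneq (dotr v v) 0.
    have vi i : v ord0 i = 0.
      have /(_ _ v0 i isT) h := @psumr_eq0P R 'I_d predT (fun j => v ord0 j * v ord0 j).
      apply/eqP; rewrite -sqrf_eq0 expr2 h// => j _.
      by rewrite -expr2 sqr_ge0.
    have -> : dotr u v = 0 by apply: big1 => i _; rewrite vi mulr0.
    by rewrite v0 mulr0 expr0n.
  have vp : 0 < dotr v v by rewrite lt_def v0 dotr_ge0.
  have := dotr_ge0 (u - (dotr u v / dotr v v) *: v).
  rewrite !dotrE (dotrC v u) => h.
  have := mulr_ge0 h (ltW vp).
  set a := dotr u v; set b := dotr v v in v0 *; set c := dotr u u.
  rewrite [X in 0 <= X](_ : _ = c * b - a ^+ 2); first by rewrite subr_ge0.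
  by field.
have := ler_norm (dotr u v); move/le_trans; apply.
by rewrite -ler_sqr ?nnegrE ?mulr_ge0 ?enorm_ge0// real_normK ?num_real.
Qed.

Lemma enorm_sqr_le (R : realType) (d : nat) (u : 'rV[R]_d) (k : R) :
  0 <= k -> (enorm u <= k) = (dotr u u <= k ^+ 2).
Proof. by move=> k0; rewrite -sqr_enorm ler_sqr ?nnegrE ?enorm_ge0. Qed.

Lemma enormD (R : realType) (d : nat) (u v : 'rV[R]_d) :
  enorm (u + v) <= enorm u + enorm v.
Proof.
rewrite enorm_sqr_le ?addr_ge0 ?enorm_ge0// !dotrE (dotrC v u) sqrrD !sqr_enorm.
have := dotr_le u v; lra.
Qed.

Lemma enormZ (R : realType) (d : nat) (k : R) (u : 'rV[R]_d) :
  enorm (k *: u) = `|k| * enorm u.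
Proof.
apply/eqP; rewrite -(@eqrXn2 _ 2)// ?mulr_ge0 ?enorm_ge0//.
by rewrite exprMn !sqr_enorm !dotrE mulrA -expr2 real_normK ?num_real.
Qed.

Lemma enormN (R : realType) (d : nat) (u : 'rV[R]_d) : enorm (- u) = enorm u.
Proof. by rewrite -scaleN1r enormZ normrN1 mul1r. Qed.

Lemma enormBC (R : realType) (d : nat) (u v : 'rV[R]_d) :
  enorm (u - v) = enorm (v - u).
Proof. by rewrite -enormN opprB. Qed.

Lemma enormB (R : realType) (d : nat) (u v : 'rV[R]_d) :
  enorm (u - v) <= enorm u + enorm v.
Proof. by rewrite -(enormN v) enormD. Qed.

Lemma enorm0 (R : realType) (d : nat) : enorm (0 : 'rV[R]_d) = 0.
Proof. by rewrite -(scale0r 0) enormZ normr0 mul0r. Qed.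

Lemma enorm_distD (R : realType) (d : nat) (w u v : 'rV[R]_d) :
  enorm (u - v) <= enorm (u - w) + enorm (w - v).
Proof. by have := enormD (u - w) (w - v); rewrite addrA subrK. Qed.

Lemma ler_dist_enorm (R : realType) (d : nat) (u v : 'rV[R]_d) :
  `|enorm u - enorm v| <= enorm (u - v).
Proof.
have := enormD (u - v) v; have := enormD (v - u) u.
by rewrite !subrK enormBC ler_norml; lra.
Qed.

Lemma abs_coord_le_enorm (R : realType) (d : nat) (u : 'rV[R]_d) (i : 'I_d) :
  `|u ord0 i| <= enorm u.
Proof.
rewrite -ler_sqr ?nnegrE ?enorm_ge0// real_normK ?num_real// sqr_enorm.
rewrite /dotr (bigD1 i)//= -expr2 lerDl.
by apply: sumr_ge0 => j _; exact: (sqr_ge0 (u ord0 j)).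
Qed.

Lemma enorm_eq0 (R : realType) (d : nat) (u : 'rV[R]_d) :
  (enorm u == 0) = (u == 0).
Proof.
apply/idP/eqP => [/eqP u0|->]; last by rewrite enorm0.
apply/rowP => i; rewrite mxE; apply/eqP; rewrite -normr_le0 -u0.
exact: abs_coord_le_enorm.
Qed.

Lemma enorm_le_norm (R : realType) (d : nat) (u : 'rV[R]_d) :
  enorm u <= d%:R * `|u|.
Proof.
have h i : `|u ord0 i| <= `|u|.
  by rewrite [leRHS]mx_normrE; apply: (le_bigmax _ _ (ord0, i)).
rewrite enorm_sqr_le ?mulr_ge0// exprMn.
have -> : d%:R ^+ 2 * `|u| ^+ 2 = d%:R * \sum_(i < d) `|u| ^+ 2 :> R.
  by rewrite sumr_const card_ord -[X in _ = _ * X]mulr_natl; ring.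
have hs : dotr u u <= \sum_(i < d) `|u| ^+ 2.
  rewrite /dotr; apply: ler_sum => i _.
  by rewrite -expr2 -real_normK ?num_real// lerXn2r ?nnegrE.
apply: (le_trans hs); case: d u h hs => [|d] u h hs.
  by rewrite big_ord0 mulr0.
by rewrite ler_peMl ?ler1n// sumr_ge0// => i _; exact: sqr_ge0.
Qed.

Lemma norm_le_enorm (R : realType) (d : nat) (u : 'rV[R]_d) : `|u| <= enorm u.
Proof.
rewrite [leLHS]mx_normrE; apply: bigmax_le => [|[i j] _]; first exact: enorm_ge0.
by rewrite (ord1 i); exact: abs_coord_le_enorm.
Qed.

Lemma unit_dotr (R : realType) (d : nat) (w e : 'rV[R]_d) :
  enorm w = 1 -> enorm e = 1 -> dotr w e = 1 - enorm (w - e) ^+ 2 / 2.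
Proof.
move=> w1 e1; rewrite sqr_enorm !dotrE (dotrC e w) -!sqr_enorm w1 e1; lra.
Qed.

(** This is the component orthogonal to [w] only for a unit vector [w]; it is applied to unit
    tangents. *)
Definition perp (R : realType) (d : nat) (v w : 'rV[R]_d) : 'rV[R]_d :=
  v - dotr v w *: w.

Lemma perpDl (R : realType) (d : nat) (u v w : 'rV[R]_d) :
  perp (u + v) w = perp u w + perp v w.
Proof. by rewrite /perp dotrDl scalerDl opprD addrACA. Qed.

Lemma perpNl (R : realType) (d : nat) (v w : 'rV[R]_d) :
  perp (- v) w = - perp v w.
Proof. by rewrite /perp dotrNl scaleNr opprB opprK addrC. Qed.

Lemma sqr_enorm_perp (R : realType) (d : nat) (v w : 'rV[R]_d) :
  enorm w = 1 -> enorm (perp v w) ^+ 2 = dotr v v - dotr v w ^+ 2.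
Proof.
move=> w1; have ww : dotr w w = 1 by rewrite -sqr_enorm w1 expr1n.
by rewrite sqr_enorm !dotrE ww (dotrC w v); ring.
Qed.

Lemma enorm_perp_le (R : realType) (d : nat) (v w : 'rV[R]_d) (k : R) :
  enorm w = 1 -> enorm (perp v w) <= enorm (v - k *: w).
Proof.
move=> w1; rewrite enorm_sqr_le ?enorm_ge0// sqr_enorm -sqr_enorm sqr_enorm_perp//.
have ww : dotr w w = 1 by rewrite -sqr_enorm w1 expr1n.
rewrite !dotrE ww (dotrC w v) -subr_ge0.
set a := dotr v w.
rewrite [X in 0 <= X](_ : _ = (k - a) ^+ 2); last by ring.
exact: sqr_ge0.
Qed.

Lemma perp_le (R : realType) (d : nat) (v w : 'rV[R]_d) :
  enorm w = 1 -> enorm (perp v w) <= enorm v.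
Proof. by move=> /(enorm_perp_le v 0); rewrite scale0r subr0. Qed.

(** As [dist_line] stands in the denominator of the radius, this direction of comparison bounds the
    energy density from below by an explicit projection. *)
Lemma perp_le_dist_line (R : realType) (d : nat) (v w : 'rV[R]_d) :
  enorm w = 1 -> enorm (perp v w) <= dist_line v w.
Proof.
move=> w1; apply: lb_le_inf; first by exists (enorm (v - 0 *: w)), 0.
by move=> _ [k _ <-]; exact: enorm_perp_le.
Qed.

(** * One-sided derivatives and unit speed curves *)

Lemma near_enormP (R : realType) (d : nat) (F : set_system R) (FF : Filter F)
    (f : R -> 'rV[R]_d) (l : 'rV[R]_d) :
  f @ F --> l <->
  forall e : R, 0 < e -> \forall u \near F, enorm (f u - l) < e.
Proof.
split=> [/cvgrPdist_lt h e e0|h].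
  have d0 : 0 < d.+1%:R :> R by rewrite ltr0n.
  have := h (e / d.+1%:R) (divr_gt0 e0 d0).
  apply: filterS => u; rewrite distrC ltr_pdivlMr// => hu.
  apply: le_lt_trans hu; rewrite mulrC (le_trans (enorm_le_norm _))//.
  by rewrite ler_wpM2r// ler_nat.
apply/cvgrPdist_lt => e /h; apply: filterS => u hu.
by rewrite distrC (le_lt_trans (norm_le_enorm _)).
Qed.

Lemma within_nearP (R : realType) (A P : set R) (t : R) :
  (\forall u \near within A (nbhs t), P u) <->
  exists2 r : R, 0 < r & forall u, A u -> `|u - t| < r -> P u.
Proof.
rewrite near_withinE; split=> [/nbhs_ballP[r /= r0 h]|[r r0 h]].
  by exists r => // u Au ur; apply: h => //; rewrite /ball /= distrC.
by apply/nbhs_ballP; exists r => //= u; rewrite /ball /= distrC => ur Au; exact: h.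
Qed.

Lemma within_dnbhs_nearP (R : realType) (A P : set R) (t : R) :
  (\forall u \near within A (dnbhs t), P u) <->
  exists2 r : R, 0 < r & forall u, A u -> u != t -> `|u - t| < r -> P u.
Proof.
rewrite near_withinE /dnbhs near_withinE.
split=> [/nbhs_ballP[r /= r0 h]|[r r0 h]].
  by exists r => // u Au ut ur; apply: h => //; rewrite /ball /= distrC.
by apply/nbhs_ballP; exists r => //= u; rewrite /ball /= distrC => ur ut Au; exact: h.
Qed.

(** The derivative as a relation in Euclidean epsilon-delta form: it makes sense before the limit is
    known to be unique, and it passes to subsets of [A]. *)
Definition has_derive_within (R : realType) (d : nat) (A : set R)
    (f : R -> 'rV[R]_d) (t : R) (l : 'rV[R]_d) : Prop :=
  forall e : R, 0 < e -> exists2 r : R, 0 < r &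
    forall u, A u -> u != t -> `|u - t| < r ->
      enorm (difference_quotient f t u - l) < e.

Lemma has_derive_withinP (R : realType) (d : nat) (A : set R)
    (f : R -> 'rV[R]_d) (t : R) (l : 'rV[R]_d) :
  difference_quotient f t u @[u --> within A (dnbhs t)] --> l <->
  has_derive_within A f t l.
Proof.
rewrite near_enormP; split=> h e e0.
  exact/within_dnbhs_nearP/h.
exact/within_dnbhs_nearP/h.
Qed.

Lemma derivable_has_derive_within (R : realType) (d : nat) (A : set R)
    (f : R -> 'rV[R]_d) (t : R) :
  derivable_within A f t -> has_derive_within A f t (derive_within A f t).
Proof. by move=> h; apply/has_derive_withinP. Qed.

Definition limit_point_of (R : realType) (A : set R) (t : R) : Prop :=
  forall r : R, 0 < r -> exists u, [/\ A u, u != t & `|u - t| < r].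

(** At an isolated point of [A] the punctured filter is trivial and [lim] carries no information; a
    limit point makes the filter proper, hence the limit unique. *)
Lemma has_derive_within_val (R : realType) (d : nat) (A : set R)
    (f : R -> 'rV[R]_d) (t : R) (l : 'rV[R]_d) :
  limit_point_of A t -> has_derive_within A f t l ->
  derivable_within A f t /\ derive_within A f t = l.
Proof.
move=> At /has_derive_withinP h.
have FF : ProperFilter (within A (dnbhs t)).
  apply: Build_ProperFilter_ex => P /within_dnbhs_nearP[r r0 hP].
  by have [u [Au ut ur]] := At _ r0; exists u; exact: hP.
by split; [apply/cvg_ex; exists l|exact/cvg_lim].
Qed.

Lemma has_derive_within_sub (R : realType) (d : nat) (A B : set R)
    (f : R -> 'rV[R]_d) (t : R) (l : 'rV[R]_d) :
  B `<=` A -> has_derive_within A f t l -> has_derive_within B f t l.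
Proof.
by move=> BA h e /h[r r0 {}h]; exists r => // u /BA; exact: h.
Qed.

Lemma has_derive_within_cont (R : realType) (d : nat) (A : set R)
    (f : R -> 'rV[R]_d) (t : R) (l : 'rV[R]_d) :
  has_derive_within A f t l ->
  forall e : R, 0 < e -> exists2 r : R, 0 < r &
    forall u, A u -> `|u - t| < r -> enorm (f u - f t) < e.
Proof.
move=> h e e0; have [r r0 {}h] := h 1 ltr01.
have l1 : 0 < enorm l + 1 by rewrite ltr_wpDl ?enorm_ge0.
exists (Num.min r (e / (enorm l + 1))); first by rewrite lt_min r0 divr_gt0.
move=> u Au; rewrite lt_min => /andP[ur ue].
have [->|ut] := eqVneq u t; first by rewrite subrr enorm0.
have ut0 : u - t != 0 by rewrite subr_eq0.
have -> : f u - f t = (u - t) *: difference_quotient f t u.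
  by rewrite /difference_quotient scalerA divff// scale1r.
rewrite enormZ; move: ue; rewrite ltr_pdivlMr//; apply: le_lt_trans.
rewrite ler_wpM2l//.
have := enormD (difference_quotient f t u - l) l; rewrite subrK => /le_trans; apply.
by rewrite addrC lerD2l ltW// h.
Qed.

(** Precomposing with this retraction onto [[0, L]] extends the curve and its tangent continuously
    to the whole line, so that measurability and compactness arguments run with globally continuous
    maps. *)
Definition clamp (R : realType) (L t : R) : R := Num.min (Num.max t 0) L.

Lemma clamp_id (R : realType) (L t : R) : t \in `[0, L] -> clamp L t = t.
Proof. by rewrite in_itv => /andP[t0 tL]; rewrite /clamp max_l// min_l. Qed.

Lemma clamp_in (R : realType) (L t : R) : 0 <= L -> clamp L t \in `[0, L].
Proof.
by move=> L0; rewrite in_itv /= /clamp le_min le_max ge_min !lexx L0 !orbT.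
Qed.

Lemma clamp_dist (R : realType) (L s t : R) :
  0 <= L -> `|clamp L s - clamp L t| <= `|s - t|.
Proof.
move=> L0; have h1 : s - t <= `|s - t| := ler_norm _.
have h2 : t - s <= `|s - t| by rewrite distrC ler_norm.
have h0 : 0 <= `|s - t| := normr_ge0 _.
rewrite /clamp; case: (leP s 0) => ?; case: (leP t 0) => ?;
  case: (leP s L) => ?; case: (leP t L) => ?; rewrite ?(min_l L0);
  rewrite ler_norml; apply/andP; split; lra.
Qed.

Definition econtinuous (R : realType) (d : nat) (G : R -> 'rV[R]_d) : Prop :=
  forall t e : R, 0 < e -> exists2 r : R, 0 < r &
    forall u, `|u - t| < r -> enorm (G u - G t) < e.

(** Only the derivative relation is confined to [[0, L]]; continuity and unit length hold on the
    whole line. The notion is stable under reversal of the parameter, which serves the chart at the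
    end [L]. *)
Definition unit_speed (R : realType) (d : nat) (L : R)
    (G T : R -> 'rV[R]_d) : Prop :=
  [/\ econtinuous G, econtinuous T, forall t, enorm (T t) = 1 &
      forall t, t \in `[0, L] -> has_derive_within `[0, L] G t (T t)].

Lemma enorm_dist_continuous (R : realType) (d : nat) (T : R -> 'rV[R]_d)
    (z : 'rV[R]_d) :
  econtinuous T -> continuous (fun s => enorm (T s - z)).
Proof.
move=> cT t; apply/cvgrPdist_lt => e e0.
have [r r0 h] := cT t e e0.
apply/nbhs_ballP; exists r => //= u; rewrite /ball /= distrC => /h.
apply: le_lt_trans; rewrite (enormBC (T u) (T t)).
have := ler_dist_enorm (T t - z) (T u - z).
by rewrite opprB addrA subrK.
Qed.

Lemma C1_on_unit_speed (R : realType) (d : nat) (L : R)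
    (gamma : R -> 'rV[R]_d) :
  0 < L -> C1_on `[0, L] gamma -> arclength_param L gamma ->
  unit_speed L (gamma \o clamp L) (derive_within `[0, L] gamma \o clamp L).
Proof.
move=> L0 [dg cg] gu.
have cl t := clamp_in t (ltW L0).
have clD t u r : `|u - t| < r -> `|clamp L u - clamp L t| < r.
  by apply: le_lt_trans; exact: clamp_dist (ltW L0).
split=> /=.
- move=> t e e0.
  have /has_derive_within_cont h := derivable_has_derive_within (dg _ (cl t)).
  have [r r0 {}h] := h e e0; exists r => // u /clD ur.
  by apply: h => //; exact: cl.
- move=> t e e0; move/subspace_continuousP : cg => /(_ _ (cl t)).
  move=> /near_enormP /(_ e e0) /within_nearP[r r0 h].
  by exists r => // u /clD ur; apply: h => //; exact: cl.
- by move=> t; apply: gu; exact: cl.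
- move=> t tL; rewrite clamp_id//.
  move=> e e0; have [r r0 h] := derivable_has_derive_within (dg _ tL) e0.
  exists r => // u uL ut ur; have := h u uL ut ur.
  by rewrite /difference_quotient /= !clamp_id.
Qed.

Lemma abs_dotr_le (R : realType) (d : nat) (u v : 'rV[R]_d) :
  `|dotr u v| <= enorm u * enorm v.
Proof.
rewrite ler_norml dotr_le andbT lerNl -dotrNl.
by rewrite (le_trans (dotr_le _ _))// enormN.
Qed.

Lemma dotr_continuous (R : realType) (d : nat) (G : R -> 'rV[R]_d)
    (e : 'rV[R]_d) :
  econtinuous G ->
  continuous (fun u => dotr (G u) e).
Proof.
move=> cG t; apply/cvgrPdist_lt => eps eps0.
have e1 : 0 < enorm e + 1 by rewrite ltr_wpDl ?enorm_ge0.
have [r r0 h] := cG t _ (divr_gt0 eps0 e1).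
apply/nbhs_ballP; exists r => //= u; rewrite /ball /= distrC => /h.
rewrite ltr_pdivlMr// distrC -dotrNl -dotrDl.
apply: le_lt_trans; rewrite (le_trans (abs_dotr_le _ _))//.
by rewrite ler_wpM2l ?enorm_ge0// lerDl.
Qed.

Lemma is_derive_dotr (R : realType) (d : nat) (L : R) (G : R -> 'rV[R]_d)
    (e : 'rV[R]_d) (t : R) (l : 'rV[R]_d) :
  t \in `]0, L[ -> has_derive_within `[0, L] G t l ->
  is_derive t 1 (fun u => dotr (G u) e) (dotr l e).
Proof.
rewrite in_itv /= => /andP[t0 tL] dG.
set f := fun u => dotr (G u) e.
have h : (fun h : R => h^-1 *: ((f \o shift t) (h *: 1) - f t)) @ 0^' -->
         dotr l e.
  apply/cvgrPdist_lt => eps eps0.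
  have e1 : 0 < enorm e + 1 by rewrite ltr_wpDl ?enorm_ge0.
  have [r r0 h] := dG _ (divr_gt0 eps0 e1).
  rewrite /dnbhs near_withinE; apply/nbhs_ballP.
  (* This radius keeps [x + t] inside [[0, L]], so that at an interior point the derivative within
     the interval is a full one. *)
  exists (Num.min r (Num.min t (L - t))).
    by rewrite /= !lt_min r0 t0 subr_gt0.
  move=> x; rewrite /ball /= sub0r normrN !lt_min => /and3P[xr xt xL] x0.
  have xD : `[0, L]%classic (x + t).
    rewrite /= in_itv /=; move: xt xL; rewrite !ltr_norml.
    by move=> /andP[? ?] /andP[? ?]; apply/andP; split; lra.
  have ht : x + t != t by rewrite -subr_eq0 addrK.
  have := h _ xD ht; rewrite addrK => /(_ xr).
  rewrite ltr_pdivlMr//; apply: le_lt_trans.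
  rewrite distrC /f /= [x *: 1]mulr1 /difference_quotient addrK.
  have -> : x^-1 *: (dotr (G (x + t)) e - dotr (G t) e) - dotr l e =
            dotr (x^-1 *: (G (x + t) - G t) - l) e.
    by rewrite !dotrE.
  rewrite (le_trans (abs_dotr_le _ _))//.
  by rewrite ler_wpM2l ?enorm_ge0// lerDl.
split; first by apply/cvg_ex; exists (dotr l e).
exact/cvg_lim.
Qed.

(** The mean value theorem fails for vector-valued maps, so it is applied to the coordinate along a
    fixed [e]; the point [u] depends on [e]. *)
Lemma unit_speed_MVT (R : realType) (d : nat) (L : R) (G T : R -> 'rV[R]_d)
    (e : 'rV[R]_d) (s t : R) :
  unit_speed L G T -> 0 <= s -> s < t -> t <= L ->
  exists2 u, s < u < t & dotr (G t - G s) e = dotr (T u) e * (t - s).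
Proof.
move=> [cG _ _ dG] s0 st tL.
have [||u] := @MVT R (fun u => dotr (G u) e) (fun u => dotr (T u) e) s t st.
- move=> u; rewrite in_itv /= => /andP[su ut].
  have u0 : u \in `]0, L[ by rewrite in_itv /=; apply/andP; split; lra.
  apply: is_derive_dotr (u0) (dG _ _).
  by rewrite in_itv /=; apply/andP; split; lra.
- exact/continuous_subspaceT/dotr_continuous.
- by rewrite in_itv /= => sut h; exists u => //; rewrite dotrDl dotrNl.
Qed.

(** The mean value theorem along the chord [e] itself gives
    [|e|^2 = (T u . e) (t - s) <= |e| (t - s)]. *)
Lemma unit_speed_lipschitz (R : realType) (d : nat) (L : R)
    (G T : R -> 'rV[R]_d) (s t : R) :
  unit_speed L G T -> s \in `[0, L] -> t \in `[0, L] ->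
  enorm (G t - G s) <= `|t - s|.
Proof.
move=> us; wlog st : s t / s <= t => [hw|].
  by case: (leP s t) => [/hw//|/ltW /hw h ? ?]; rewrite enormBC distrC h.
move: st; rewrite le_eqVlt => /predU1P[->|st]; first by rewrite subrr enorm0.
rewrite !in_itv /= => /andP[s0 sL] /andP[t0 tL].
set e := G t - G s.
have [u _ h] := unit_speed_MVT e us s0 st tL.
rewrite gtr0_norm ?subr_gt0//.
have [e0|e0] := eqVneq (enorm e) 0; first by rewrite e0 subr_ge0 ltW.
have ep : 0 < enorm e by rewrite lt_def e0 enorm_ge0.
rewrite -(ler_pM2l ep) -expr2 sqr_enorm h ler_wpM2r ?subr_ge0 ?(ltW st)//.
by have [_ _ T1 _] := us; have := dotr_le (T u) e; rewrite T1 mul1r.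
Qed.

(** By [unit_dotr], [|T u - e| <= 1] means [T u . e >= 1/2]. *)
Lemma unit_speed_expand (R : realType) (d : nat) (L : R)
    (G T : R -> 'rV[R]_d) (e : 'rV[R]_d) (s t : R) :
  unit_speed L G T -> 0 <= s -> s <= t -> t <= L -> enorm e = 1 ->
  (forall u, s <= u <= t -> enorm (T u - e) <= 1) ->
  (t - s) / 2 <= dotr (G t - G s) e.
Proof.
move=> us s0; rewrite le_eqVlt => /predU1P[->|st] tL e1 he.
  by rewrite !subrr mul0r -(scale0r e) dotrZl mul0r.
have [u /andP[su ut] ->] := unit_speed_MVT e us s0 st tL.
have [_ _ T1 _] := us.
rewrite (unit_dotr (T1 u) e1).
have : enorm (T u - e) ^+ 2 <= 1.
  by rewrite expr_le1 ?enorm_ge0// he// !ltW.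
nra.
Qed.

Lemma unit_speed_expand_norm (R : realType) (d : nat) (L : R)
    (G T : R -> 'rV[R]_d) (e : 'rV[R]_d) (s t : R) :
  unit_speed L G T -> 0 <= s -> s <= t -> t <= L -> enorm e = 1 ->
  (forall u, s <= u <= t -> enorm (T u - e) <= 1) ->
  t - s <= 2 * enorm (G t - G s).
Proof.
move=> us s0 st tL e1 he.
have := unit_speed_expand us s0 st tL e1 he.
have := dotr_le (G t - G s) e; rewrite e1; lra.
Qed.

(* Both [a T(s)] and [b T(t)], the projections of the chord on the two tangent
   lines, are close to the chord, hence to each other, and [a, b >= h / 2]. *)
Lemma tangent_dist_le (R : realType) (d : nat) (L : R)
    (G T : R -> 'rV[R]_d) (s t : R) :
  unit_speed L G T -> 0 <= s -> s <= t -> t <= L ->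
  (forall u, s <= u <= t -> enorm (T u - T s) <= 1) ->
  (forall u, s <= u <= t -> enorm (T u - T t) <= 1) ->
  enorm (T s - T t) * (t - s) <=
  4 * (enorm (perp (G s - G t) (T s)) + enorm (perp (G t - G s) (T t))).
Proof.
move=> us s0 st tL hs ht; have [_ _ T1 _] := us.
have := unit_speed_expand us s0 st tL (T1 s) hs.
have := unit_speed_expand us s0 st tL (T1 t) ht.
have -> : enorm (perp (G s - G t) (T s)) = enorm (perp (G t - G s) (T s)).
  by rewrite -(opprB (G t)) perpNl enormN.
set D := G t - G s; set b := dotr D (T t); set a := dotr D (T s) => hb ha.
set n1 := perp D (T s); set n2 := perp D (T t).
have h1 : D = a *: T s + n1 by rewrite /n1 /perp addrC subrK.
have h2 : D = b *: T t + n2 by rewrite /n2 /perp addrC subrK.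
have h3 : a *: T s - b *: T t = n2 - n1.
  by apply/eqP; rewrite subr_eq addrAC -subr_eq opprK -h1 addrC -h2.
have h4 : enorm (a *: T s - b *: T t) <= enorm n1 + enorm n2.
  by rewrite h3 [leRHS]addrC; exact: enormB.
have a0 : 0 <= a by lra.
have b0 : 0 <= b by lra.
have h5 : `|b - a| <= enorm n1 + enorm n2.
  apply: le_trans h4; rewrite distrC.
  have := ler_dist_enorm (a *: T s) (b *: T t).
  by rewrite !enormZ !T1 !mulr1 (ger0_norm a0) (ger0_norm b0).
have h6 : a * enorm (T s - T t) <= 2 * (enorm n1 + enorm n2).
  have -> : a * enorm (T s - T t) =
            enorm ((a *: T s - b *: T t) + (b - a) *: T t).
    rewrite -[in LHS](ger0_norm a0) -enormZ scalerBr scalerBl.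
    by rewrite addrA subrK.
  have := enormD (a *: T s - b *: T t) ((b - a) *: T t).
  by rewrite enormZ T1 mulr1; lra.
have := enorm_ge0 (T s - T t); nra.
Qed.

(** * Integration *)

(* No measurability is needed: the integral of a nonnegative function is a
   supremum over the simple functions below it. *)
Lemma ge0_le_integral_nomeas (R : realType) (disp : measure_display)
    (T : measurableType disp) (mu : {measure set T -> \bar R}) (D : set T)
    (f g : T -> \bar R) :
  (forall x, D x -> (0 <= f x)%E) -> (forall x, D x -> (f x <= g x)%E) ->
  (\int[mu]_(x in D) f x <= \int[mu]_(x in D) g x)%E.
Proof.
move=> f0 fg; rewrite !(integral_mkcond D).
have g0 x : D x -> (0 <= g x)%E by move=> Dx; exact: le_trans (f0 _ Dx) (fg _ Dx).
rewrite !ge0_integralTE; try by move=> y; exact: erestrict_ge0.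
apply: le_ereal_sup => _ [h /= hf <-]; exists h => //= x.
by apply: le_trans (hf x) _; exact: lee_restrict.
Qed.

Lemma ge_cst_integral (R : realType) (disp : measure_display)
    (T : measurableType disp) (mu : {measure set T -> \bar R}) (D B : set T)
    (F : T -> \bar R) (c : \bar R) :
  measurable D -> measurable B -> B `<=` D -> (0 <= c)%E ->
  (forall x, D x -> (0 <= F x)%E) -> (forall x, B x -> (c <= F x)%E) ->
  (c * mu B <= \int[mu]_(x in D) F x)%E.
Proof.
move=> mD mB BD c0 F0 cF.
rewrite -(integral_cst mu mB) -(setIidr BD) integral_mkcondr.
apply: ge0_le_integral_nomeas => x Dx; rewrite patchE; case: ifPn => //.
  by rewrite inE => /cF.
by move=> _; exact: F0.
Qed.

(** The window [B] and the level [c] may vary with [t]; only their product has to stay above [m]. *)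
Lemma ge_cst_integral2 (R : realType) (disp : measure_display)
    (T : measurableType disp) (mu : {measure set T -> \bar R}) (D A : set T)
    (F : T -> T -> \bar R) (m : \bar R) :
  measurable D -> measurable A -> A `<=` D -> (0 <= m)%E ->
  (forall t s, (0 <= F t s)%E) ->
  (forall t, A t -> exists B c, [/\ measurable B, B `<=` D, (0 <= c)%E,
     (forall s, B s -> (c <= F t s)%E) & (m <= c * mu B)%E]) ->
  (m * mu A <= \int[mu]_(t in D) \int[mu]_(s in D) F t s)%E.
Proof.
move=> mD mA AD m0 F0 h.
apply: ge_cst_integral => // t; first by move=> _; exact: integral_ge0.
move=> /h[B [c [mB BD c0 cF]]] /le_trans; apply.
exact: ge_cst_integral.
Qed.

(** Extension by zero outside the square of [D] reduces this to Tonelli on the whole space;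
    additivity is then available on the product. *)
Lemma integral2_setX (R : realType) (disp : measure_display)
    (T : measurableType disp) (mu : {sigma_finite_measure set T -> \bar R})
    (D : set T) (f : T * T -> \bar R) :
  measurable D -> measurable_fun setT f -> (forall z, (0 <= f z)%E) ->
  (\int[mu]_(t in D) \int[mu]_(s in D) f (t, s)
   = \int[mu \x mu]_(z in D `*` D) f z)%E.
Proof.
move=> mD mf f0.
have mDD : measurable (D `*` D) by exact: measurableX.
rewrite [RHS]integral_mkcond fubini_tonelli1/=; last 2 first.
- exact/(measurable_restrictT _ _).1/measurable_funTS.
- by move=> z; exact: erestrict_ge0.
rewrite [LHS]integral_mkcond; apply: eq_integral => t _.
rewrite /fubini_F patchE; case: ifPn => tD.
  rewrite [LHS]integral_mkcond; apply: eq_integral => s _; rewrite !patchE.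
  have -> // : ((t, s) \in D `*` D) = (s \in D).
  by rewrite in_setX /= tD.
rewrite integral0_eq// => s _; rewrite patchE.
by rewrite in_setX /= (negbTE tD).
Qed.

Lemma measurable_fun_swap (R : realType) (disp : measure_display)
    (T : measurableType disp) (f : T * T -> R) :
  measurable_fun setT f -> measurable_fun setT (fun z => f (z.2, z.1)).
Proof.
by move=> mf; apply: measurableT_comp => //; exact: measurable_swap.
Qed.

Lemma integral_swap_sum (R : realType) (disp : measure_display)
    (T : measurableType disp) (mu : {sigma_finite_measure set T -> \bar R})
    (D : set T) (f : T * T -> R) :
  measurable D -> measurable_fun setT f -> (forall z, 0 <= f z) ->
  (\int[mu]_(t in D) \int[mu]_(s in D)
     (f (s, t) + f (t, s))%:E
   = 2%:E * \int[mu]_(t in D) \int[mu]_(s in D)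
       (f (s, t))%:E)%E.
Proof.
move=> mD mf f0.
have mE : measurable_fun setT (EFin \o f) by exact/measurable_EFinP.
have msw : measurable_fun setT (EFin \o (fun z => f (z.2, z.1))).
  by apply/measurable_EFinP; exact: (measurable_fun_swap mf).
have mDD : measurable (D `*` D) by exact: measurableX.
have h1 := @integral2_setX R _ T mu D (EFin \o f) mD mE (fun z => f0 z).
have h2 := @integral2_setX R _ T mu D _ mD msw (fun z => f0 (z.2, z.1)).
rewrite /= in h1 h2.
rewrite (@integral2_setX R _ T mu D (fun z => (f (z.2, z.1) + f z)%:E))//; last 2 first.
- under eq_fun do rewrite EFinD. exact: emeasurable_funD.
- by move=> z; rewrite lee_fin addr_ge0.
under eq_integral do rewrite EFinD.
rewrite ge0_integralD//; last 4 first.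
- by move=> z _; rewrite lee_fin.
- exact: measurable_funTS.
- by move=> z _; rewrite lee_fin.
- exact: measurable_funTS.
have h3 : (\int[mu]_(t in D) \int[mu]_(s in D)
             (f (s, t))%:E =
           \int[mu]_(t in D) \int[mu]_(s in D)
             (f (t, s))%:E)%E.
  have mr : measurable_fun setT ((EFin \o f) \_ (D `*` D)).
    exact/(measurable_restrictT _ _).1/measurable_funTS.
  have r0 z : (0 <= ((EFin \o f) \_ (D `*` D)) z)%E.
    by apply: erestrict_ge0 => y _; rewrite lee_fin.
  have := fubini_tonelli (m1 := mu) (m2 := mu)
    _ mr r0.
  have hr (t s : T) : ((EFin \o f) \_ (D `*` D)) (t, s) =
      if t \in D then (if s \in D then (f (t, s))%:E else 0%E) else 0%E.
    by rewrite patchE in_setX /=; case: (t \in D).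
  move=> h; rewrite integral_mkcond [RHS]integral_mkcond; symmetry.
  transitivity (\int[mu]_x \int[mu]_y
     ((EFin \o f) \_ (D `*` D)) (x, y))%E.
    apply: eq_integral => t _; rewrite patchE; case: ifPn => tD.
      by rewrite [LHS]integral_mkcond; apply: eq_integral => s _; rewrite hr tD patchE.
    by rewrite integral0_eq// => s _; rewrite hr (negbTE tD).
  rewrite h; apply: eq_integral => t _; rewrite patchE; case: ifPn => tD.
    rewrite [RHS]integral_mkcond; apply: eq_integral => s _; rewrite hr tD patchE.
    by case: ifP.
  by rewrite integral0_eq// => s _; rewrite hr (negbTE tD); case: ifP.
rewrite -h1 -h2 h3; set I := (\int[_]_(_ in _) _)%E.
by rewrite -[2]/(1 + 1) EFinD ge0_muleDl ?lee_fin// mul1e.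
Qed.

(** * Tangent-point energy *)

(** For a zero chord the right side is [+oo]; for a tangential chord both sides vanish; otherwise
    the projection is at most the distance to the tangent line. *)
Lemma rtp_ge (R : realType) (d : nat) (p L : R) (gamma : R -> 'rV[R]_d)
    (s t : R) (w := derive_within `[0, L] gamma s) (v := gamma s - gamma t) :
  0 < p -> enorm w = 1 ->
  (((2 * enorm (perp v w) / enorm v ^+ 2) `^ p)%:E <=
   (rtp L gamma s t `^ p)^-1)%E.
Proof.
move=> p0 w1; have pn0 : p != 0 by rewrite gt_eqF.
rewrite /rtp -/v -/w; case: ifPn => [_|v0].
  by rewrite poweR_EFin powR0// inve0 leey.
have ev : 0 < enorm v by rewrite lt_def enorm_eq0 v0 enorm_ge0.
case: asboolP => [[k vk]|nk].
  rewrite poweRyr// invey.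
  have ww : dotr w w = 1 by rewrite -sqr_enorm w1 expr1n.
  have -> : perp v w = 0 by rewrite /perp vk dotrZl ww mulr1 subrr.
  by rewrite enorm0 mulr0 mul0r powR0.
have K0 : 0 < enorm (perp v w).
  rewrite lt_def enorm_ge0 andbT enorm_eq0; apply/eqP => h; apply: nk.
  by exists (dotr v w); apply/eqP; rewrite -subr_eq0 -/(perp v w) h.
have Kd := perp_le_dist_line v w1.
have d0 : 0 < dist_line v w := lt_le_trans K0 Kd.
have r0 : 0 < enorm v ^+ 2 / (2 * dist_line v w).
  by rewrite divr_gt0 ?exprn_gt0 ?mulr_gt0.
rewrite poweR_EFin inver gt_eqF ?powR_gt0// lee_fin.
rewrite -powRN -mulN1r powRrM powR_inv1 ?(ltW r0)//.
apply: ge0_ler_powR; rewrite ?nnegrE ?(ltW p0) ?invr_ge0 ?(ltW r0)//.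
  by rewrite divr_ge0 ?mulr_ge0 ?enorm_ge0 ?exprn_ge0.
by rewrite invf_div ler_wpM2r ?invr_ge0 ?exprn_ge0 ?enorm_ge0// ler_wpM2l.
Qed.

(** A measurable substitute for the energy density: the chord length is replaced by [|s - t|], which
    dominates it by unit speed, and the distance to the tangent line by the projection. *)
Definition tp_quot (R : realType) (d : nat) (p : R) (G T : R -> 'rV[R]_d)
    (s t : R) : R :=
  (enorm (perp (G s - G t) (T s)) / (s - t) ^+ 2) `^ p.

Lemma tp_quot_le (R : realType) (d : nat) (p L : R) (gamma : R -> 'rV[R]_d)
    (G T : R -> 'rV[R]_d) (s t : R) :
  unit_speed L G T ->
  {in `[0, L], gamma =1 G} -> {in `[0, L], derive_within `[0, L] gamma =1 T} ->
  0 < p -> s \in `[0, L] -> t \in `[0, L] ->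
  ((2 `^ p * tp_quot p G T s t)%:E <= (rtp L gamma s t `^ p)^-1)%E.
Proof.
move=> us gG gT p0 sD tD; have [_ _ T1 _] := us.
have w1 : enorm (derive_within `[0, L] gamma s) = 1 by rewrite gT.
apply: le_trans (rtp_ge t p0 w1); rewrite lee_fin gT// !gG//.
set v := G s - G t; rewrite /tp_quot -powRM//; last first.
  by rewrite divr_ge0 ?enorm_ge0 ?sqr_ge0.
have K0 := enorm_ge0 (perp v (T s)).
apply: ge0_ler_powR; rewrite ?nnegrE ?(ltW p0) ?mulr_ge0 ?invr_ge0 ?sqr_ge0//.
rewrite mulrA; have [v0|v0] := eqVneq v 0.
  have -> : perp v (T s) = 0.
    by rewrite v0 -(scale0r (T s)) /perp dotrZl mul0r !scale0r subrr.
  by rewrite enorm0 mulr0 !mul0r.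
have ev : 0 < enorm v by rewrite lt_def enorm_eq0 v0 enorm_ge0.
have vst : enorm v <= `|s - t| := unit_speed_lipschitz us tD sD.
have st0 : 0 < `|s - t| := lt_le_trans ev vst.
have st2 : 0 < (s - t) ^+ 2.
  by rewrite -real_normK ?num_real// exprn_gt0.
rewrite ler_wpM2l ?mulr_ge0// lef_pV2 ?posrE ?st2 ?(exprn_gt0 _ ev)//.
by rewrite -[leRHS]real_normK ?num_real// lerXn2r ?nnegrE ?enorm_ge0.
Qed.

Lemma continuous_coord (R : realType) (d : nat) (G : R -> 'rV[R]_d) (i : 'I_d) :
  econtinuous G ->
  continuous (fun u => G u ord0 i).
Proof.
move=> cG t; apply/cvgrPdist_lt => eps eps0.
have [r r0 h] := cG t _ eps0.
apply/nbhs_ballP; exists r => //= u; rewrite /ball /= distrC => /h.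
rewrite distrC; apply: le_lt_trans.
by have := abs_coord_le_enorm (G u - G t) i; rewrite !mxE.
Qed.

Lemma measurable_tp_quot (R : realType) (d : nat) (p L : R)
    (G T : R -> 'rV[R]_d) :
  unit_speed L G T ->
  measurable_fun setT (fun z : measurableTypeR R * measurableTypeR R =>
    tp_quot p G T z.1 z.2).
Proof.
move=> [cG cT _ _].
pose P := (measurableTypeR R * measurableTypeR R)%type.
have m1 (f : R -> R) : continuous f -> measurable_fun setT (fun z : P => f z.1).
  move=> /continuous_measurable_fun mf.
  exact: (measurableT_comp mf (@measurable_fst _ _ _ _)).
have m2 (f : R -> R) : continuous f -> measurable_fun setT (fun z : P => f z.2).
  move=> /continuous_measurable_fun mf.
  exact: (measurableT_comp mf (@measurable_snd _ _ _ _)).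
have mT i : measurable_fun setT (fun z : P => T z.1 ord0 i).
  exact: (m1 _ (continuous_coord (i := i) cT)).
have mv i : measurable_fun setT (fun z : P => (G z.1 - G z.2) ord0 i).
  under eq_fun do rewrite !mxE.
  apply: measurable_funB.
    exact: (m1 _ (continuous_coord (i := i) cG)).
  exact: (m2 _ (continuous_coord (i := i) cG)).
have mdot (f g : P -> 'rV[R]_d) :
    (forall i, measurable_fun setT (fun z => f z ord0 i)) ->
    (forall i, measurable_fun setT (fun z => g z ord0 i)) ->
    measurable_fun setT (fun z => dotr (f z) (g z)).
  by move=> mf mg; apply: measurable_sum => i; exact: measurable_funM.
have mperp i : measurable_fun setT
    (fun z : P => (perp (G z.1 - G z.2) (T z.1)) ord0 i).
  rewrite (_ : (fun _ => _) = fun z : P => (G z.1 - G z.2) ord0 i -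
     dotr (G z.1 - G z.2) (T z.1) * T z.1 ord0 i); last first.
    by apply/funext => z; rewrite /perp !mxE.
  apply: measurable_funB => //; apply: measurable_funM => //.
  exact: mdot.
have mnorm : measurable_fun setT
    (fun z : P => enorm (perp (G z.1 - G z.2) (T z.1))).
  rewrite (_ : (fun _ => _) = fun z : P =>
     Num.sqrt (dotr (perp (G z.1 - G z.2) (T z.1))
                    (perp (G z.1 - G z.2) (T z.1)))).
    apply: (measurableT_comp (f := @Num.sqrt R)); last exact: mdot.
    apply: continuous_measurable_fun; exact: sqrt_continuous.
  by apply/funext => z; rewrite enormE.
rewrite /tp_quot; apply: (measurableT_comp (measurable_powR p)).
apply: measurable_funM => //.
rewrite (_ : (fun _ => _) = fun z : P => ((z.1 - z.2) ^+ 2) `^ (-1)).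
  apply: (measurableT_comp (measurable_powR (-1))).
  apply: measurable_funX; apply: measurable_funB.
  - exact: measurable_fst.
  - exact: measurable_snd.
by apply/funext => z; rewrite powR_inv1 ?sqr_ge0.
Qed.

Lemma EtpE (R : realType) (d : nat) (p L : R) (gamma : R -> 'rV[R]_d) :
  arclength_param L gamma ->
  Etp p L gamma =
  (\int[lebesgue_measure]_(t in `[0%R, L]) \int[lebesgue_measure]_(s in `[0%R, L])
     (rtp L gamma s t `^ p)^-1)%E.
Proof.
move=> gu; apply: eq_integral => t tD; apply: eq_integral => s sD.
by rewrite !gu ?mulr1 ?mul1e; rewrite ?inE in tD sD *.
Qed.

Lemma rtp_powV_ge0 (R : realType) (d : nat) (p L : R) (gamma : R -> 'rV[R]_d)
    (s t : R) :
  (0 <= (rtp L gamma s t `^ p)^-1)%E.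
Proof. by rewrite inve_ge0 poweR_ge0. Qed.

Lemma Etp_ge0 (R : realType) (d : nat) (p L : R) (gamma : R -> 'rV[R]_d) :
  arclength_param L gamma -> (0 <= Etp p L gamma)%E.
Proof.
move=> gu; rewrite EtpE//; apply: integral_ge0 => t _.
by apply: integral_ge0 => s _; exact: rtp_powV_ge0.
Qed.

(** If the ends met, the logarithm would make the energy [+oo]. Otherwise their distance is at most
    [L], and [ln L < L] lets the length term absorb the logarithm, which leaves the bound on
    [Etp]. *)
Lemma energyR_bounds (R : realType) (d : nat) (p L M : R)
    (gamma : R -> 'rV[R]_d) (G T : R -> 'rV[R]_d) :
  0 < L -> arclength_param L gamma -> unit_speed L G T ->
  {in `[0, L], gamma =1 G} -> (energyR p L gamma <= M%:E)%E ->
  [/\ (Etp p L gamma <= (2 `^ p * M)%:E)%E, L <= 2 * M + 4 &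
      gamma 0 != gamma L].
Proof.
move=> L0 gu us gG; rewrite /energyR.
have -> : (\int[lebesgue_measure]_(t in `[0%R, L])
      (enorm (derive_within `[0%R, L] gamma t))%:E)%E = L%:E.
  rewrite (eq_integral (cst 1%E)); last by move=> t; rewrite inE => /gu ->.
  by rewrite integral_cst//= mul1e lebesgue_measure_itv /= lte_fin L0 oppr0 adde0.
have D0 : 0 \in `[0, L] by rewrite in_itv /= lexx ltW.
have DL : L \in `[0, L] by rewrite in_itv /= lexx ltW.
have eL : enorm (gamma 0 - gamma L) <= L.
  have := unit_speed_lipschitz us DL D0.
  by rewrite !gG// sub0r normrN gtr0_norm.
have := enorm_ge0 (gamma 0 - gamma L); rewrite le_eqVlt.
set E := Etp p L gamma; have E0 : (0 <= E)%E by exact: Etp_ge0.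
have c0 : 0 < 2 `^ (- p) :> R by exact: powR_gt0.
have cE0 : (0 <= (2 `^ (- p))%:E * E)%E by rewrite mule_ge0// lee_fin ltW.
move=> /predU1P[<-|e0].
  rewrite le0_lneNy//=.
  rewrite [X in (X + L%:E)%E](_ : _ = +oo%E) ?addye//.
  by rewrite addey// gt_eqF// (lt_le_trans _ cE0)// ltNyr.
rewrite lne_EFin//.
have h1 : ln (enorm (gamma 0 - gamma L)) <= ln L by rewrite ler_ln.
have h2 : ln L < L by exact: ln_sublinear.
(* A slope 1/2 instead of 1 leaves half of the length in the energy, whence [L <= 2 * M + 4]. *)
have h3 : ln L < L / 2 + 2.
  have -> : ln L = ln 2 + ln (L / 2).
    by rewrite -lnM ?posrE ?divr_gt0// mulrC divfK.
  have h2l : ln 2 < 2 :> R by apply: ln_sublinear.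
  have h2r : ln (L / 2) < L / 2 by apply: ln_sublinear; rewrite divr_gt0.
  lra.
have g0L : gamma 0 != gamma L.
  by rewrite -subr_eq0 -enorm_eq0 gt_eqF.
case: E E0 cE0 => [r| |]// E0 cE0.
  rewrite -EFinM -EFinB -EFinD lee_fin => h.
  rewrite EFinM in cE0 *; rewrite -!EFinM !lee_fin in E0 cE0 *.
  split => //; last by lra.
  have h4 : 2 `^ (- p) * r <= M by lra.
  have := ler_wpM2l (powR_ge0 2 p) h4.
  by rewrite mulrA powRN divff ?mul1r// gt_eqF ?powR_gt0.
by rewrite gt0_muley ?lte_fin// addye// addye.
Qed.

Definition tp_sym (R : realType) (d : nat) (p : R) (G T : R -> 'rV[R]_d)
    (s t : R) : R :=
  2 `^ p * tp_quot p G T s t + 2 `^ p * tp_quot p G T t s.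

Lemma tp_sym_ge0 (R : realType) (d : nat) (p : R) (G T : R -> 'rV[R]_d)
    (s t : R) : 0 <= tp_sym p G T s t.
Proof. by rewrite addr_ge0// mulr_ge0// powR_ge0. Qed.

(** The exchange of integrals is made for the measurable [tp_quot]; the passage to the energy
    density comes last and uses monotonicity only. *)
Lemma integral_tp_sym_le (R : realType) (d : nat) (p L : R)
    (gamma : R -> 'rV[R]_d) (G T : R -> 'rV[R]_d) :
  arclength_param L gamma -> unit_speed L G T ->
  {in `[0, L], gamma =1 G} -> {in `[0, L], derive_within `[0, L] gamma =1 T} ->
  0 < p ->
  (\int[lebesgue_measure]_(t in `[0%R, L]) \int[lebesgue_measure]_(s in `[0%R, L])
     (tp_sym p G T s t)%:E <= 2%:E * Etp p L gamma)%E.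
Proof.
move=> gu us gG gT p0.
have mf : measurable_fun setT
    (fun z : measurableTypeR R * measurableTypeR R =>
       2 `^ p * tp_quot p G T z.1 z.2).
  by apply: measurable_funM => //; exact: measurable_tp_quot us.
have f0 (z : measurableTypeR R * measurableTypeR R) :
    0 <= 2 `^ p * tp_quot p G T z.1 z.2.
  by rewrite mulr_ge0// powR_ge0.
have := @integral_swap_sum R _ _ (@lebesgue_measure R) `[0, L]%classic _
  (measurable_itv _) mf f0.
rewrite /= => ->; rewrite lee_wpmul2l// EtpE//.
apply: ge0_le_integral_nomeas => t tD.
  by apply: integral_ge0 => s _; rewrite lee_fin (f0 (s, t)).
apply: ge0_le_integral_nomeas => s sD; first by rewrite lee_fin (f0 (s, t)).
exact: tp_quot_le us gG gT p0 sD tD.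
Qed.

Lemma tangent_quot_le (R : realType) (d : nat) (p L : R)
    (G T : R -> 'rV[R]_d) (s t : R) :
  unit_speed L G T -> 0 <= p -> s \in `[0, L] -> t \in `[0, L] ->
  (forall u v, Num.min s t <= u <= Num.max s t ->
     Num.min s t <= v <= Num.max s t -> enorm (T u - T v) <= 1) ->
  (enorm (T s - T t) / `|s - t|) `^ p <= 4 `^ p * tp_sym p G T s t.
Proof.
move=> us p0 sD tD osc.
wlog st : s t sD tD osc / s <= t.
  move=> hw; case: (leP s t) => [st|/ltW ts]; first exact: hw.
  rewrite enormBC distrC [tp_sym _ _ _ _ _]addrC; apply: hw => //.
  by rewrite minC maxC.
move: osc; rewrite min_l// max_r// => osc.
move: st; rewrite le_eqVlt => /predU1P[->|st].
  rewrite subrr enorm0 mul0r.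
  have [->|pn0] := eqVneq p 0; last by rewrite powR0// mulr_ge0 ?powR_ge0 ?tp_sym_ge0.
  by rewrite powRr0 /tp_sym /tp_quot !powRr0 !mul1r lerDl.
move: sD tD; rewrite !in_itv /= => /andP[s0 sL] /andP[t0 tL].
have [ss tt] : s <= s <= t /\ s <= t <= t by rewrite !lexx (ltW st).
have := tangent_dist_le us s0 (ltW st) tL
  (fun u hu => osc u s hu ss) (fun u hu => osc u t hu tt).
set h := t - s; have h0 : 0 < h by rewrite subr_gt0.
set K1 := enorm (perp _ (T s)); set K2 := enorm (perp _ (T t)) => hK.
have K10 : 0 <= K1 by exact: enorm_ge0.
have K20 : 0 <= K2 by exact: enorm_ge0.
have -> : `|s - t| = h by rewrite distrC gtr0_norm.
have -> : tp_sym p G T s t =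
    2 `^ p * (K1 / h ^+ 2) `^ p + 2 `^ p * (K2 / h ^+ 2) `^ p.
  by rewrite /tp_sym /tp_quot (_ : (s - t) ^+ 2 = h ^+ 2)// -sqrrN opprB.
(* Here [K1 + K2 <= 2 * K] for [K] the larger of the two, whose power is one of the terms of
   [tp_sym]; the maximum takes the place of a convexity inequality. *)
have bound K : K1 <= K -> K2 <= K ->
    (enorm (T s - T t) / h) `^ p <= 4 `^ p * (2 `^ p * (K / h ^+ 2) `^ p).
  move=> K1K K2K; have K0 : 0 <= K by lra.
  have Kh0 : 0 <= K / h ^+ 2 by rewrite divr_ge0 ?exprn_ge0 ?(ltW h0).
  have T0 : 0 <= enorm (T s - T t) / h by rewrite divr_ge0 ?enorm_ge0 ?(ltW h0).
  have -> : 4 `^ p * (2 `^ p * (K / h ^+ 2) `^ p) = (4 * (2 * (K / h ^+ 2))) `^ p.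
    rewrite (powRM (x := 4)) ?(powRM (x := 2))//; last by rewrite mulr_ge0.
  apply: ge0_ler_powR; rewrite ?nnegrE//; first by rewrite mulr_ge0 ?(mulr_ge0 _ Kh0).
  rewrite ler_pdivrMr// (_ : _ * h = 8 * K / h); last by field; rewrite gt_eqF.
  by rewrite ler_pdivlMr//; lra.
case: (leP K1 K2) => [/bound/(_ (lexx _))|/ltW K21].
  move=> /le_trans; apply; rewrite ler_wpM2l ?powR_ge0// lerDr.
  by rewrite mulr_ge0 ?powR_ge0.
apply: le_trans (bound _ (lexx _) K21) _.
by rewrite ler_wpM2l ?powR_ge0// lerDl mulr_ge0 ?powR_ge0.
Qed.

(** * Modulus of continuity of the tangent *)

Lemma compact_min (R : realType) (K : set R) :
  K !=set0 -> compact K -> exists2 m, K m & forall v, K v -> m <= v.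
Proof.
move=> K0 cK.
have ci : {within K, continuous (@idfun R)}.
  by apply: continuous_subspaceT => x; exact: cvg_id.
have [m mK hm] := compact_EVT_min K0 cK ci.
exists m; first by rewrite inE in mK.
by move=> v vK; apply: hm; rewrite inE.
Qed.

(** [m] is the least point of the level set in [[a, b]]; a value above [c] before [m] would produce
    an earlier hit by the intermediate value theorem. *)
Lemma first_hit (R : realType) (f : R -> R) (a b c : R) :
  continuous f -> a <= b -> f a < c -> c <= f b ->
  exists2 m, a < m <= b & f m = c /\ forall v, a <= v <= m -> f v <= c.
Proof.
move=> cf ab fac cfb.
pose K := `[a, b]%classic `&` f @^-1` [set c].
have cl : closed (f @^-1` [set c]).
  by apply: preimage_closed => //; exact: closed_eq.
have cK : compact K by apply: compact_closedI => //; exact: segment_compact.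
have ivt y : a <= y -> c <= f y -> exists2 u, a <= u <= y & f u = c.
  move=> ay cy; have [|u] := @IVT R f a y c ay (continuous_subspaceT cf).
    by rewrite ge_min le_max (ltW fac) cy orbT.
  by rewrite in_itv /=; exists u.
have K0 : K !=set0.
  have [u uab fu] := ivt b ab cfb.
  by exists u; split => //=; rewrite in_itv.
have [m [/= mab fm] hm] := compact_min K0 cK.
move: mab; rewrite in_itv /= => /andP[am mb].
exists m.
  by rewrite mb andbT lt_neqAle am andbT; apply: contraTneq fac => ->; rewrite fm ltxx.
split => // v /andP[av vm]; rewrite leNgt; apply/negP => cv.
have [u /andP[au uv] fu] := ivt v av (ltW cv).
have mu : m <= u.
  by apply: hm; split => //=; rewrite in_itv /= au; lra.
have vE : v = m by lra.
by move: cv; rewrite vE fm ltxx.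
Qed.

(** [k.+1] is the first scale at which [g] is below its threshold on more than half of [B]. Scale
    [N] has this property and scale 0 lacks it, so at the preceding scale at least half of [B k]
    lies above the threshold. *)
Lemma majority_switch (R : realType) (B : nat -> set R) (r eps : nat -> R)
    (g : R -> R) :
  (forall k, measurable (B k)) ->
  (forall k, @lebesgue_measure R (B k) = (r k)%:E) -> (forall k, 0 < r k) ->
  continuous g ->
  (exists N, forall s, B N s -> g s <= eps N) ->
  (@lebesgue_measure R (B 0%N `&` [set s | (g s <= eps 0%N)%R])
     <= (r 0%N / 2)%:E)%E ->
  exists k,
    [/\ measurable (B k `&` [set s | eps k < g s]),
        measurable (B k.+1 `&` [set s | g s <= eps k.+1]),
        ((r k / 2)%:E <= @lebesgue_measure R (B k `&` [set s | (eps k < g s)%R]))%E &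
        ((r k.+1 / 2)%:E <=
         @lebesgue_measure R (B k.+1 `&` [set s | (g s <= eps k.+1)%R]))%E].
Proof.
move=> mB rB r0 cg [N hN] h0.
have mg : measurable_fun setT g by exact: continuous_measurable_fun.
have ml k : measurable [set s | g s <= eps k].
  rewrite -[X in measurable X]setTI.
  have -> : [set s | g s <= eps k] = g @^-1` `]-oo, eps k].
    by apply/seteqP; split => s /=; rewrite in_itv.
  exact: mg.
have mlt k : measurable [set s | eps k < g s].
  have -> : [set s | eps k < g s] = ~` [set s | g s <= eps k].
    by apply/seteqP; split => s /=; rewrite ltNge => /negP.
  exact: measurableC.
pose P k := `[< ((r k / 2)%:E <
  @lebesgue_measure R (B k `&` [set s | (g s <= eps k)%R]))%E >].
have PN : P N.
  apply/asboolP; rewrite (_ : _ `&` _ = B N).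
    by rewrite rB lte_fin; have := r0 N; lra.
  by apply/seteqP; split => [s []//|s Bs]; split => //; exact: hN.
have exP : exists k, P k by exists N.
case: (ex_minnP exP) => -[|k] Pk mink.
  by move/asboolP : Pk; rewrite ltNge h0.
have nPk : ~~ P k by apply/negP => /mink; rewrite ltnn.
exists k; split; [exact: measurableI|exact: measurableI| |].
- have := @measureDI _ _ _ (@lebesgue_measure R) (B k) [set s | g s <= eps k]
    (mB k) (ml k).
  have -> : B k `\` [set s | g s <= eps k] = B k `&` [set s | eps k < g s].
    apply/seteqP; split => s /= [Bs h]; split => //.
      by rewrite ltNge; exact/negP.
    by apply/negP; rewrite -ltNge.
  have aux (c : R) (x y : \bar R) : (0 <= x)%E -> (0 <= y)%E ->
      (y <= (c / 2)%:E)%E -> c%:E = (x + y)%E -> ((c / 2)%:E <= x)%E.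
    case: x y => [x| |] [y| |]//; rewrite ?leey// -EFinD !lee_fin => x0 y0 yc [].
    lra.
  have nPk' : (@lebesgue_measure R (B k `&` [set s | (g s <= eps k)%R])
      <= (r k / 2)%:E)%E.
    by move: nPk => /asboolPn /negP; rewrite -leNgt.
  move=> h; apply: aux nPk' _; [exact: measure_ge0|exact: measure_ge0|].
  by rewrite -rB; exact: h.
- by move/asboolP : Pk => /ltW.
Qed.

(* The exponent 1 - 2/p makes an oscillation [scale_ratio p ^+ k] at scale
   [2 ^- k] cost the same energy for all [k]. *)
Definition scale_ratio (R : realType) (p : R) : R := 2 `^ (- ((p - 2) / p)).

(** The factor [4^p] comes from [tangent_quot_le], [(1 - scale_ratio p) / 16] from the gap between
    consecutive thresholds, and 8 from the product of half of one interval with half of the next,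
    which is twice shorter. *)
Definition scale_const (R : realType) (p : R) : R :=
  (4 `^ p)^-1 * ((1 - scale_ratio p) / 16) `^ p / 8.

(** The ratio is below 1 because [2 < p] makes the exponent [(p - 2) / p] positive; this is what
    makes the thresholds decrease. *)
Lemma scale_ratio_itv (R : realType) (p : R) :
  2 < p -> 0 < scale_ratio p < 1.
Proof.
move=> p2; rewrite powR_gt0//= /scale_ratio powRN invf_lt1 ?powR_gt0//.
rewrite -[ltLHS](powRr0 2) /powR !gt_eqF// ltr_expR.
by rewrite ltr_pM2r ?ln_gt0 ?ltr1n// divr_gt0//; lra.
Qed.

Lemma scale_const_gt0 (R : realType) (p : R) : 2 < p -> 0 < scale_const p.
Proof.
move=> /scale_ratio_itv /andP[q0 q1].
by rewrite /scale_const !(mulr_gt0, invr_gt0, powR_gt0)// subr_gt0.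
Qed.

Lemma powR_expn (R : realType) (x p : R) (k : nat) :
  0 <= x -> (x ^+ k) `^ p = (x `^ p) ^+ k.
Proof.
by move=> x0; rewrite -powR_mulrn// powRAC powR_mulrn// powR_ge0.
Qed.

Lemma scale_invariance (R : realType) (p l : R) (k : nat) :
  2 < p -> 0 < l ->
  ((1 - scale_ratio p) / 16 * scale_ratio p ^+ k / (l / 2 ^+ k)) `^ p *
    (l / 2 ^+ k) ^+ 2 =
  ((1 - scale_ratio p) / 16) `^ p * (l ^+ 2 / l `^ p).
Proof.
move=> p2 l0; have /andP[q0 q1] := scale_ratio_itv p2.
set q := scale_ratio p in q0 q1 *.
have c1 : 0 <= 1 - q by lra.
set c := (1 - q) / 16; have c0 : 0 <= c by rewrite /c; lra.
have l1 : 0 <= l^-1 by rewrite invr_ge0 ltW.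
have e2 : (0 : R) <= 2 ^+ k by rewrite exprn_ge0.
have -> : c * q ^+ k / (l / 2 ^+ k) = c * (q * 2) ^+ k * l^-1.
  by rewrite exprMn; field; rewrite gt_eqF//= gt_eqF ?exprn_gt0.
rewrite !powRM ?mulr_ge0 ?exprn_ge0 ?mulr_ge0 ?(ltW q0)//.
rewrite powR_expn ?mulr_ge0 ?(ltW q0)//.
(* As [q = 2^(-1 + 2/p)], halving the scale multiplies the [p]-th power of the quotient by 4 and the
   area by 1/4. *)
have -> : (q * 2) `^ p = 2 ^+ 2.
  rewrite powRM ?(ltW q0)// -powR_mulrn// /q /scale_ratio -powRrM -powRD.
    by congr powR; field; lra.
  by rewrite pnatr_eq0 implybT.
have -> : l^-1 `^ p = (l `^ p)^-1.
  by rewrite -powR_inv1 ?(ltW l0)// -powRrM mulN1r powRN.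
have -> : (l / 2 ^+ k) ^+ 2 = l ^+ 2 / (2 ^+ 2) ^+ k.
  by rewrite expr_div_n -!exprM mulnC.
by field; rewrite !gt_eqF ?powR_gt0 ?exprn_gt0.
Qed.

Lemma exists_scale_lt (R : realType) (l r : R) :
  0 <= l -> 0 < r -> exists N : nat, l / 2 ^+ N < r.
Proof.
move=> l0 r0; exists (Num.bound (l / r)).
rewrite ltr_pdivrMr ?exprn_gt0// mulrC -ltr_pdivrMr//.
have lr0 : 0 <= l / r by rewrite divr_ge0 ?(ltW r0).
apply: (lt_trans (archi_boundP lr0)).
by rewrite -natrX ltr_nat ltn_expl.
Qed.

(** The Morrey step at one end [z]. At the switching scale, halves of [B k] and [B k.+1] carry
    tangents whose distances to [T z] differ by the threshold gap, while their parameters are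
    [(y - x) / 2 ^+ k] close; by [scale_invariance] the resulting energy does not depend on the
    unknown [k]. *)
Lemma switch_energy (R : realType) (d : nat) (p L K x y z : R)
    (G T : R -> 'rV[R]_d) (B : nat -> set R) :
  2 < p -> unit_speed L G T -> 0 <= x -> x < y -> y <= L ->
  (\int[lebesgue_measure]_(t in `[0%R, L]) \int[lebesgue_measure]_(s in `[0%R, L])
     (tp_sym p G T s t)%:E <= K%:E)%E ->
  (forall u v, x <= u <= y -> x <= v <= y -> enorm (T u - T v) <= 1) ->
  (forall k, measurable (B k)) ->
  (forall k, @lebesgue_measure R (B k) = ((y - x) / 2 ^+ k)%:E) ->
  (forall k, B k `<=` `[x, y]) -> (forall k, B k.+1 `<=` B k) ->
  (forall k s t, B k s -> B k t -> `|s - t| <= (y - x) / 2 ^+ k) ->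
  (forall k s, B k s -> `|s - z| <= (y - x) / 2 ^+ k) ->
  (@lebesgue_measure R (B 0%N `&` [set s | (enorm (T s - T z) <= 8^-1)%R])
     <= ((y - x) / 2)%:E)%E ->
  scale_const p * ((y - x) ^+ 2 / (y - x) `^ p) <= K.
Proof.
move=> p2 us x0 xy yL EK osc mB lB Bxy BS Bd Bz B0.
have /andP[q0 q1] := scale_ratio_itv p2.
set q := scale_ratio p in q0 q1.
have l0 : 0 < y - x by rewrite subr_gt0.
set l := y - x in l0 lB Bd Bz B0 *.
have [_ cT _ _] := us.
pose g s := enorm (T s - T z).
(* The thresholds decrease from 1/8 to 1/16; since the limit is positive,
   continuity makes the majority good at small scales. *)
pose eps (k : nat) : R := 16^-1 + 16^-1 * q ^+ k.
have cg : continuous g by exact: enorm_dist_continuous.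
have r0 k : 0 < l / 2 ^+ k by rewrite divr_gt0 ?exprn_gt0.
have hN : exists N, forall s, B N s -> g s <= eps N.
  have e16 : (0 : R) < 16^-1 by [].
  have [r rp h] := cT z _ e16.
  have [N hN] := exists_scale_lt (ltW l0) rp.
  exists N => s /Bz sN; apply: (@le_trans _ _ 16^-1).
    by apply/ltW/h; exact: le_lt_trans hN.
  by rewrite lerDl mulr_ge0 ?exprn_ge0 ?(ltW q0).
have h0 : (@lebesgue_measure R (B 0%N `&` [set s | (g s <= eps 0%N)%R])
            <= (l / 2 ^+ 0 / 2)%:E)%E.
  by rewrite expr0 divr1 /eps expr0 mulr1 (_ : 16^-1 + 16^-1 = 8^-1)//; lra.
have [k [m1 m2 k1 k2]] := majority_switch mB lB r0 cg hN h0.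
set S1 := _ `&` _ in m1 k1; set S2 := _ `&` _ in m2 k2.
(* The gap between consecutive thresholds, a lower bound for the difference of tangents taken on
   [S1] and on [S2]. *)
set dk := (1 - q) / 16 * q ^+ k.
have dkE : dk = eps k - eps k.+1 by rewrite /dk /eps exprS; field.
have dk0 : 0 < dk by rewrite /dk mulr_gt0 ?exprn_gt0// divr_gt0// subr_gt0.
pose c := (4 `^ p)^-1 * (dk / (l / 2 ^+ k)) `^ p.
have c0 : 0 <= c by rewrite mulr_ge0 ?invr_ge0 ?powR_ge0.
have BD j : B j `<=` `[0, L]%classic.
  move=> s /Bxy; rewrite /= !in_itv /= => /andP[? ?]; apply/andP; split; lra.
have hc t s : S1 t -> S2 s -> c <= tp_sym p G T s t.
  move=> [Bt gt] [Bs gs]; rewrite /= in gt gs.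
  have Bks : B k s by exact: BS.
  have tD := BD _ _ Bt; have sD := BD _ _ Bks.
  have hT : dk <= enorm (T s - T t).
    have := enorm_distD (T s) (T t) (T z); rewrite -/(g s) -/(g t).
    by rewrite enormBC; lra.
  have st : `|s - t| <= l / 2 ^+ k by exact: Bd.
  have st0 : 0 < `|s - t|.
    rewrite normr_gt0 subr_eq0; apply: contraTneq hT => ->.
    by rewrite subrr enorm0 -ltNge.
  rewrite /c mulrC ler_pdivrMr ?powR_gt0// [leRHS]mulrC.
  apply: (@le_trans _ _ ((enorm (T s - T t) / `|s - t|) `^ p)); last first.
    apply: (tangent_quot_le us) => //; first by lra.
    move: (Bxy _ _ Bks) (Bxy _ _ Bt); rewrite /= !in_itv /= => /andP[? ?] /andP[? ?].
    move=> u v /andP[u1 u2] /andP[v1 v2]; apply: osc; apply/andP; split.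
    - by apply: le_trans u1; rewrite le_min; apply/andP.
    - by apply: le_trans u2 _; rewrite ge_max; apply/andP.
    - by apply: le_trans v1; rewrite le_min; apply/andP.
    - by apply: le_trans v2 _; rewrite ge_max; apply/andP.
  have n1 : 0 <= dk / (l / 2 ^+ k) by rewrite (divr_ge0 (ltW dk0) (ltW (r0 k))).
  have n2 : 0 <= enorm (T s - T t) / `|s - t| by rewrite divr_ge0 ?enorm_ge0.
  apply: ge0_ler_powR => //; first by lra.
  apply: ler_pM; rewrite ?(ltW dk0) ?invr_ge0 ?(ltW (r0 k))//.
  by rewrite lef_pV2 ?posrE.
have m0 : (0 <= (c * (l / 2 ^+ k.+1 / 2))%:E)%E.
  by rewrite lee_fin mulr_ge0// divr_ge0// ltW.
have := @ge_cst_integral2 R _ _ (@lebesgue_measure R) `[0, L]%classic S1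
  (fun t s => (tp_sym p G T s t)%:E) _ (measurable_itv _) m1 _ m0.
have S1D : S1 `<=` `[0, L]%classic by move=> t [/BD].
move=> /(_ S1D) H.
have {}H := H (fun t s => tp_sym_ge0 _ _ _ _ _).
have {}H : ((c * (l / 2 ^+ k.+1 / 2))%:E * @lebesgue_measure R S1 <= K%:E)%E.
  apply: le_trans EK; apply: H => t S1t; exists S2, c%:E.
  split => //; first by move=> s [/BD].
    by move=> s S2s; rewrite lee_fin; exact: hc.
  by rewrite EFinM lee_wpmul2l.
have {}H : ((c * (l / 2 ^+ k.+1 / 2) * (l / 2 ^+ k / 2))%:E <= K%:E)%E.
  by apply: le_trans H; rewrite [X in (X <= _)%E]EFinM lee_wpmul2l.
move: H; rewrite lee_fin; apply: le_trans.
have := scale_invariance k p2 l0; rewrite -/q -/dk => E.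
rewrite /scale_const -/q /c.
have -> : l / 2 ^+ k.+1 / 2 = l / 2 ^+ k / 4.
  by rewrite exprS; field; rewrite gt_eqF ?exprn_gt0.
set a := (4 `^ p)^-1; set w := (dk / _) `^ p in E *; set v := l / 2 ^+ k in E *.
have -> : a * w * (v / 4) * (v / 2) = a * (w * v ^+ 2) / 8 by field.
by rewrite E le_eqVlt; apply/orP; left; apply/eqP; ring.
Qed.

Lemma integral2_affine (R : realType) (disp : measure_display)
    (T : measurableType disp) (mu : {sigma_finite_measure set T -> \bar R})
    (D : set T) (f : T * T -> R) (a c : R) :
  measurable D -> measurable_fun setT f -> (forall z, 0 <= f z) ->
  0 <= a -> 0 <= c ->
  (\int[mu]_(t in D) \int[mu]_(s in D) (a * f (t, s) + c)%:E
   = a%:E * \int[mu]_(t in D) \int[mu]_(s in D) (f (t, s))%:E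
     + c%:E * mu D * mu D)%E.
Proof.
move=> mD mf f0 a0 c0.
have mDD : measurable (D `*` D) by exact: measurableX.
have mE : measurable_fun setT (EFin \o f) by exact/measurable_EFinP.
have maf : measurable_fun setT (fun z => (a * f z)%:E).
  by apply/measurable_EFinP; exact: measurable_funM.
rewrite (@integral2_setX R _ T mu D (fun z => (a * f z + c)%:E))//; last 2 first.
- by under eq_fun do rewrite EFinD; apply: emeasurable_funD.
- by move=> z; rewrite lee_fin addr_ge0// mulr_ge0.
under eq_integral do rewrite EFinD.
rewrite ge0_integralD//; last 2 first.
- by move=> z _; rewrite lee_fin mulr_ge0.
- exact: measurable_funTS.
congr (_ + _)%E.
  under eq_integral do rewrite EFinM.
  rewrite ge0_integralZl ?lee_fin//; last 2 first.
  - exact: measurable_funTS.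
  - by move=> z _; rewrite lee_fin.
  by rewrite (@integral2_setX R _ T mu D (EFin \o f)).
rewrite -(@integral2_setX R _ T mu D (cst c%:E))//=.
under eq_integral do rewrite integral_cst//.
by rewrite integral_cst.
Qed.

(** As [T x] and [T m] are 1/2 apart, no tangent is within 1/8 of both. One of the two sets of close
    parameters thus fills at most half of [[x, m]], and [switch_energy] applies at that end. *)
Lemma first_hit_switch (R : realType) (d : nat) (p L K x m : R)
    (G T : R -> 'rV[R]_d) :
  2 < p -> unit_speed L G T -> 0 <= x -> x < m -> m <= L ->
  (\int[lebesgue_measure]_(t in `[0%R, L]) \int[lebesgue_measure]_(s in `[0%R, L])
     (tp_sym p G T s t)%:E <= K%:E)%E ->
  (forall u v, x <= u <= m -> x <= v <= m -> enorm (T u - T v) <= 1) ->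
  enorm (T m - T x) = 2^-1 ->
  scale_const p * ((m - x) ^+ 2 / (m - x) `^ p) <= K.
Proof.
move=> p2 us x0 xm mL EK osc Tmx.
have l0 : 0 < m - x by rewrite subr_gt0.
set l := m - x in l0 *; have lE : l = m - x by [].
have r0 k : 0 < l / 2 ^+ k by rewrite divr_gt0 ?exprn_gt0.
have rl k : l / 2 ^+ k <= l.
  by rewrite ler_pdivrMr ?exprn_gt0// ler_peMr ?(ltW l0)// exprn_ege1// ler1n.
have rS k : l / 2 ^+ k.+1 <= l / 2 ^+ k.
  have := r0 k; rewrite exprS (_ : l / (2 * 2 ^+ k) = l / 2 ^+ k / 2); first lra.
  by field; rewrite gt_eqF ?exprn_gt0.
pose B1 k := `[x, x + l / 2 ^+ k]%classic.
pose B2 k := `[m - l / 2 ^+ k, m]%classic.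
pose A1 := B1 0%N `&` [set s | enorm (T s - T x) <= 8^-1].
pose A2 := B2 0%N `&` [set s | enorm (T s - T m) <= 8^-1].
have h1 : (@lebesgue_measure R A1 <= (l / 2)%:E)%E ->
    scale_const p * (l ^+ 2 / l `^ p) <= K.
  apply: (@switch_energy R d p L K x m x G T B1) => //.
  - by move=> k; exact: measurable_itv.
  - move=> k; rewrite /B1 lebesgue_measure_itv /= lte_fin ltrDl r0 -EFinD.
    by rewrite addrAC subrr add0r.
  - move=> k s; rewrite /B1 /= !in_itv /= => /andP[? ?]; apply/andP; split => //.
    by have := rl k; lra.
  - move=> k s; rewrite /B1 /= !in_itv /= => /andP[? ?]; apply/andP; split => //.
    by have := rS k; lra.
  - move=> k s t; rewrite /B1 /= !in_itv /= => /andP[? ?] /andP[? ?].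
    by rewrite -/l ler_norml; apply/andP; split; lra.
  - move=> k s; rewrite /B1 /= !in_itv /= => /andP[? ?].
    by rewrite -/l ler_norml; apply/andP; split; have := r0 k; lra.
have h2 : (@lebesgue_measure R A2 <= (l / 2)%:E)%E ->
    scale_const p * (l ^+ 2 / l `^ p) <= K.
  apply: (@switch_energy R d p L K x m m G T B2) => //.
  - by move=> k; exact: measurable_itv.
  - move=> k; rewrite /B2 lebesgue_measure_itv /= lte_fin ltrBlDr ltrDl r0 -EFinD.
    by rewrite opprB addrCA subrr addr0.
  - move=> k s; rewrite /B2 /= !in_itv /= => /andP[? ?]; apply/andP; split => //.
    by have := rl k; lra.
  - move=> k s; rewrite /B2 /= !in_itv /= => /andP[? ?]; apply/andP; split => //.
    by have := rS k; lra.
  - move=> k s t; rewrite /B2 /= !in_itv /= => /andP[? ?] /andP[? ?].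
    by rewrite -/l ler_norml; apply/andP; split; lra.
  - move=> k s; rewrite /B2 /= !in_itv /= => /andP[? ?].
    by rewrite -/l ler_norml; apply/andP; split; have := r0 k; lra.
have [/h1//|A1l] := leP (@lebesgue_measure R A1) (l / 2)%:E.
have [/h2//|A2l] := leP (@lebesgue_measure R A2) (l / 2)%:E.
exfalso.
have [_ cT _ _] := us.
have cg z := enorm_dist_continuous (z := T z) cT.
have mA z : measurable [set s : R | enorm (T s - T z) <= 8^-1].
  rewrite -[X in measurable X]setTI.
  have -> : [set s | enorm (T s - T z) <= 8^-1] =
      (fun s => enorm (T s - T z)) @^-1` `]-oo, 8^-1].
    by apply/seteqP; split => s /=; rewrite in_itv.
  exact: (continuous_measurable_fun (cg z)).
have mA1 : measurable A1 by apply: measurableI; [exact: measurable_itv|exact: mA].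
have mA2 : measurable A2 by apply: measurableI; [exact: measurable_itv|exact: mA].
have A12 : A1 `&` A2 = set0.
  rewrite -subset0 => s [[_ /= s1] [_ /= s2]].
  have := enorm_distD (T s) (T m) (T x).
  by rewrite Tmx (enormBC (T m)); lra.
have hU : (@lebesgue_measure R (A1 `|` A2) <= l%:E)%E.
  have <- : @lebesgue_measure R `[x, m]%classic = l%:E.
    by rewrite lebesgue_measure_itv /= lte_fin xm.
  apply: le_measure; rewrite ?inE//; first exact: measurableU.
  have lx : x + l = m by rewrite addrC subrK.
  have lm : m - l = x by rewrite opprB addrC subrK.
  by move=> s [[]|[]]; rewrite /B1 /B2 expr0 divr1 ?lx ?lm.
have aux (X Y : \bar R) : ((l / 2)%:E < X)%E -> ((l / 2)%:E < Y)%E ->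
    (X + Y <= l%:E)%E -> False.
  case: X Y => [X| |] [Y| |]//; rewrite ?lte_fin -?EFinD ?lee_fin => ? ? ?; lra.
apply: (aux _ _ A1l A2l); rewrite -measureU//.
Qed.

(** The length [l] at which the lower bound [scale_const p * l^(2 - p)] equals [2 * K]; the factor 2
    makes the contradiction with the upper bound [K] strict. *)
Definition modulus_radius (R : realType) (p K : R) : R :=
  (scale_const p / (2 * K)) `^ ((p - 2)^-1).

Lemma modulus_radius_gt0 (R : realType) (p K : R) :
  2 < p -> 0 < K -> 0 < modulus_radius p K.
Proof.
by move=> p2 K0; rewrite powR_gt0// divr_gt0 ?scale_const_gt0// mulr_gt0.
Qed.

(* Stopping at the first point where the tangent has turned by 1/2 makes the
   estimate local, so that no bound on the modulus is needed beforehand. *)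
Lemma uniform_modulus (R : realType) (d : nat) (p L K s t : R)
    (G T : R -> 'rV[R]_d) :
  2 < p -> 0 < K -> unit_speed L G T ->
  (\int[lebesgue_measure]_(t in `[0%R, L]) \int[lebesgue_measure]_(s in `[0%R, L])
     (tp_sym p G T s t)%:E <= K%:E)%E ->
  s \in `[0, L] -> t \in `[0, L] -> `|s - t| <= modulus_radius p K ->
  enorm (T s - T t) <= 2^-1.
Proof.
move=> p2 K0 us EK; wlog st : s t / s <= t.
  move=> hw; case: (leP s t) => [/hw//|/ltW /hw h ? ? ?].
  by rewrite enormBC h// distrC.
rewrite !in_itv /= => /andP[s0 sL] /andP[t0 tL] std.
rewrite leNgt; apply/negP => hT.
have [_ cT _ _] := us.
have cg := enorm_dist_continuous (z := T s) cT.
have [||m /andP[sm mt] [fm hm]] := @first_hit R _ s t 2^-1 cg st.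
- by rewrite subrr enorm0 invr_gt0.
- by rewrite enormBC ltW.
(* Up to the first hit all tangents are within 1/2 of [T s], hence within 1 of each other, as the
   angle estimate requires. *)
have osc u v : s <= u <= m -> s <= v <= m -> enorm (T u - T v) <= 1.
  move=> /hm hu /hm hv; have := enorm_distD (T s) (T u) (T v).
  by rewrite (enormBC (T s)); lra.
have mL : m <= L by lra.
have := first_hit_switch p2 us s0 sm mL EK osc fm.
set l := m - s; have l0 : 0 < l by rewrite subr_gt0.
have ld : l <= modulus_radius p K.
  by move: std; rewrite distrC ger0_norm ?subr_ge0// /l; lra.
have -> : l ^+ 2 / l `^ p = (l `^ (p - 2))^-1.
  rewrite powRB; last by rewrite (gt_eqF l0) implybT.
  by rewrite powR_mulrn ?(ltW l0)// invf_div.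
rewrite ler_pdivrMr ?powR_gt0//.
apply/negP; rewrite -ltNge.
have cp := scale_const_gt0 p2.
have h : l `^ (p - 2) <= scale_const p / (2 * K).
  have -> : scale_const p / (2 * K) = modulus_radius p K `^ (p - 2).
    rewrite /modulus_radius -powRrM mulVf ?powRr1//; last by lra.
    by rewrite divr_ge0 ?(ltW cp)// mulr_ge0// ltW.
  by apply: ge0_ler_powR; rewrite ?nnegrE ?(ltW l0)//; lra.
apply: (@le_lt_trans _ _ (K * (scale_const p / (2 * K)))).
  by rewrite ler_wpM2l// ltW.
rewrite (_ : K * _ = scale_const p / 2); first by lra.
by field; rewrite gt_eqF.
Qed.

(** * The Slobodeckij seminorm *)

Lemma powR_div (R : realType) (a b p : R) :
  0 <= a -> 0 <= b -> a `^ p / b `^ p = (a / b) `^ p.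
Proof.
move=> a0 b0; rewrite powRM ?invr_ge0//; congr (_ * _).
by rewrite -(powR_inv1 b0) -powRrM mulN1r powRN.
Qed.

Lemma measurable_tp_sym (R : realType) (d : nat) (p L : R)
    (G T : R -> 'rV[R]_d) :
  unit_speed L G T ->
  measurable_fun setT (fun z : measurableTypeR R * measurableTypeR R =>
    tp_sym p G T z.2 z.1).
Proof.
move=> us; have m1 := measurable_tp_quot p us.
have m2 : measurable_fun setT (fun z : measurableTypeR R * measurableTypeR R =>
    tp_quot p G T z.2 z.1).
  exact: (measurable_fun_swap m1).
by apply: measurable_funD; apply: measurable_funM.
Qed.

(** [K] bounds the integral of [tp_sym] when [Etp] is at most [2^p M]. Beyond the radius the
    difference quotient of unit tangents is at most 2 over the radius, and [2 * M + 4] bounds the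
    side of the parameter square. *)
Definition slobodeckij_bound (R : realType) (p M : R) : R :=
  let K := 2 * (2 `^ p * M) in
  4 `^ p * K + (2 / modulus_radius p K) `^ p * (2 * M + 4) ^+ 2.

Lemma slobodeckij_pow_le (R : realType) (d : nat) (p L M : R)
    (G T tau : R -> 'rV[R]_d) (K := 2 * (2 `^ p * M)) :
  2 < p -> 0 < M -> 0 < L -> L <= 2 * M + 4 -> unit_speed L G T ->
  {in `[0, L], tau =1 T} ->
  (\int[lebesgue_measure]_(t in `[0%R, L]) \int[lebesgue_measure]_(s in `[0%R, L])
     (tp_sym p G T s t)%:E <= K%:E)%E ->
  (slobodeckij_pow (@enorm R d) (1 - p^-1) p 0 L tau <=
   (slobodeckij_bound p M)%:E)%E.
Proof.
move=> p2 M0 L0 LM us tauT EK; rewrite /slobodeckij_pow.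
have p0 : 0 < p by lra.
have K0 : 0 < K by rewrite !mulr_gt0 ?powR_gt0.
set r := modulus_radius p K; have r0 : 0 < r by exact: modulus_radius_gt0.
have [_ _ T1 _] := us.
set c := (2 / r) `^ p; have c0 : 0 <= c by exact: powR_ge0.
have f0 (z : measurableTypeR R * measurableTypeR R) : 0 <= tp_sym p G T z.2 z.1.
  exact: tp_sym_ge0.
have pE : 1 + (1 - p^-1) * p = p by field; lra.
(* The sum of the near and far bounds dominates the integrand everywhere, which spares a splitting
   of the parameter square. *)
apply: (@le_trans _ _ (\int[@lebesgue_measure R]_(t in `[0%R, L])
    \int[@lebesgue_measure R]_(s in `[0%R, L])
    (4 `^ p * tp_sym p G T s t + c)%:E)%E).
  apply: ge0_le_integral_nomeas => t tD.
    by apply: integral_ge0 => s _; rewrite lee_fin divr_ge0 ?powR_ge0.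
  apply: ge0_le_integral_nomeas => s sD; first by rewrite lee_fin divr_ge0 ?powR_ge0.
  have tD' : t \in `[0, L] := tD; have sD' : s \in `[0, L] := sD.
  rewrite lee_fin pE !tauT// powR_div ?enorm_ge0//.
  have [st|st] := leP `|s - t| r.
    apply: (le_trans (y := 4 `^ p * tp_sym p G T s t)); last by rewrite lerDl.
    apply: (tangent_quot_le us) => //; first by lra.
    have hmm : Num.max s t - Num.min s t <= r.
      by move: st; rewrite ler_norml => /andP[? ?]; case: (leP s t) => _; lra.
    have hmin : 0 <= Num.min s t /\ Num.max s t <= L.
      move: tD' sD'; rewrite !in_itv /= le_min ge_max.
      by move=> /andP[-> ->] /andP[-> ->].
    move=> u v /andP[u1 u2] /andP[v1 v2].
    apply: (le_trans (y := 2^-1)); last by lra.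
    apply: (uniform_modulus p2 K0 us EK); rewrite ?in_itv/=; try lra.
    by rewrite -/r ler_norml; apply/andP; split; lra.
  apply: (le_trans (y := c)); last first.
    by rewrite lerDr mulr_ge0 ?powR_ge0// (f0 (t, s)).
  have st0 : 0 < `|s - t| by exact: lt_trans st.
  apply: ge0_ler_powR; rewrite ?nnegrE ?divr_ge0 ?enorm_ge0 ?(ltW p0) ?(ltW r0)//.
  apply: ler_pM; rewrite ?enorm_ge0 ?invr_ge0//.
    by have := enormB (T s) (T t); rewrite !T1; lra.
  by rewrite lef_pV2 ?posrE// ltW.
have := @integral2_affine R _ _ (@lebesgue_measure R) `[0, L]%classic _ (4 `^ p) c
  (measurable_itv _) (measurable_tp_sym p us) f0 (powR_ge0 _ _) c0.
rewrite /= => ->.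
have muD : @lebesgue_measure R `[0, L]%classic = L%:E.
  by rewrite lebesgue_measure_itv /= lte_fin L0 oppr0 adde0.
rewrite /slobodeckij_bound -/K -/r -/c EFinD leeD//.
  by rewrite EFinM lee_wpmul2l// lee_fin powR_ge0.
rewrite [X in (_ * X * X)%E]muD -!EFinM lee_fin -mulrA ler_wpM2l//.
by rewrite -expr2 lerXn2r ?nnegrE ?(ltW L0)//; lra.
Qed.

(** * Self-contacts *)

Lemma compact_max (R : realType) (K : set R) :
  K !=set0 -> compact K -> exists2 m, K m & forall v, K v -> v <= m.
Proof.
move=> K0 cK.
have ci : {within K, continuous (@idfun R)}.
  by apply: continuous_subspaceT => x; exact: cvg_id.
have [m mK hm] := compact_EVT_max K0 cK ci.
exists m; first by rewrite inE in mK.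
by move=> v vK; apply: hm; rewrite inE.
Qed.

(** [a2] is the point of [Z] closest to [a1] between [a0] and [a1]; by extremality [Z] is avoided on
    the half-open intervals leaving [a2] towards [a1]. The two orders of [a0] and [a1] are mirror
    images. *)
Lemma exit_point (R : realType) (Z : set R) (a0 a1 : R) :
  closed Z -> Z a0 -> ~ Z a1 ->
  exists2 a2, Z a2 /\ Num.min a0 a1 <= a2 <= Num.max a0 a1 &
  exists2 rho0 : R, 0 < rho0 & forall rho, 0 < rho <= rho0 ->
    exists A : set R, [/\ measurable A, @lebesgue_measure R A = rho%:E &
      forall a, A a -> [/\ Num.min a0 a1 <= a <= Num.max a0 a1, ~ Z a &
                          `|a - a2| <= rho]].
Proof.
move=> cZ Za0 Za1.
have cK a b : compact (`[a, b]%classic `&` Z).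
  by apply: compact_closedI => //; exact: segment_compact.
have [a01|a10] := leP a0 a1.
  have K0 : (`[a0, a1]%classic `&` Z) !=set0.
    by exists a0; split => //=; rewrite in_itv /= lexx.
  have [a2 [/= a2I Za2] hmax] := compact_max K0 (cK a0 a1).
  move: a2I; rewrite in_itv /= => /andP[a02 a21].
  have a21' : a2 < a1.
    by rewrite lt_neqAle a21 andbT; apply: contra_notN Za1 => /eqP <-.
  exists a2; first by rewrite a02 a21.
  exists (a1 - a2); first by rewrite subr_gt0.
  move=> rho /andP[rho0 rho1]; exists `]a2, a2 + rho]%classic; split.
  - exact: measurable_itv.
  - rewrite lebesgue_measure_itv /= lte_fin ltrDl rho0 -EFinD.
    by rewrite addrAC subrr add0r.
  - move=> a; rewrite /= in_itv /= => /andP[a2a aa2]; split.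
    + by apply/andP; split; lra.
    + move=> Za; have : a <= a2.
        by apply: hmax; split => //=; rewrite in_itv /=; apply/andP; split; lra.
      by rewrite leNgt a2a.
    + by rewrite ler_norml; apply/andP; split; lra.
have K0 : (`[a1, a0]%classic `&` Z) !=set0.
  by exists a0; split => //=; rewrite in_itv /= lexx ltW.
have [a2 [/= a2I Za2] hmin] := compact_min K0 (cK a1 a0).
move: a2I; rewrite in_itv /= => /andP[a12 a20].
have a21' : a1 < a2.
  by rewrite lt_neqAle a12 andbT; apply: contra_notN Za1 => /eqP ->.
exists a2; first by rewrite a12 a20.
exists (a2 - a1); first by rewrite subr_gt0.
move=> rho /andP[rho0 rho1]; exists `[a2 - rho, a2[%classic; split.
- exact: measurable_itv.
- rewrite lebesgue_measure_itv /= lte_fin ltrBlDr ltrDl rho0 -EFinD.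
  by rewrite opprB addrCA subrr addr0.
- move=> a; rewrite /= in_itv /= => /andP[a2a aa2]; split.
  + by apply/andP; split; lra.
  + move=> Za; have : a2 <= a.
      by apply: hmin; split => //=; rewrite in_itv /=; apply/andP; split; lra.
    by rewrite leNgt aa2.
  + by rewrite ler_norml; apply/andP; split; lra.
Qed.

Lemma enorm_continuous (R : realType) (d : nat) (G : R -> 'rV[R]_d) :
  econtinuous G ->
  continuous G.
Proof.
move=> cG t; apply/near_enormP => e /(cG t)[r r0 h].
by apply/nbhs_ballP; exists r => //= u; rewrite /ball /= distrC => /h.
Qed.

(** As [v] is orthogonal to [e] and [w] is within 1/4 of [e], [perp v w] has length at least
    [3/4 |v|]. The displacement [r] leaves at least [|v| / 2] of it and a chord of length at most
    [5/4 |v|], so the quotient is at least [16 / (25 |v|)]. *)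
Lemma transverse_tp_radius (R : realType) (d : nat) (v w e r : 'rV[R]_d) :
  enorm w = 1 -> dotr v e = 0 -> enorm (w - e) <= 4^-1 ->
  enorm r <= enorm v / 4 -> v != 0 ->
  (2 * enorm v)^-1 <= 2 * enorm (perp (r - v) w) / enorm (r - v) ^+ 2.
Proof.
move=> w1 ve we rv v0.
have v1 : 0 < enorm v by rewrite lt_def enorm_eq0 v0 enorm_ge0.
have h1 : `|dotr v w| <= enorm v / 4.
  have -> : dotr v w = dotr v (w - e) by rewrite dotrDr dotrNr ve subr0.
  apply: (le_trans (abs_dotr_le _ _)).
  by rewrite ler_wpM2l ?enorm_ge0.
have h2 : enorm v * 3 / 4 <= enorm (perp v w).
  have := enormD (perp v w) (dotr v w *: w); rewrite /perp subrK enormZ w1.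
  lra.
have h3 : enorm v / 2 <= enorm (perp (r - v) w).
  have hr := perp_le r w1.
  have := enormB (perp r w) (perp (r - v) w).
  rewrite [X in X - _]/perp -/(perp r w) -perpNl -perpDl opprB addrC subrK; lra.
have h4 : enorm (r - v) <= 5 / 4 * enorm v by have := enormB r v; lra.
have h5 : enorm v * 3 / 4 <= enorm (r - v).
  have := enormB r (r - v); rewrite opprB addrC subrK; lra.
have h6 : 0 < enorm (r - v) by lra.
rewrite ler_pdivlMr ?exprn_gt0// mulrC ler_pdivrMr ?mulr_gt0//.
have : enorm (r - v) ^+ 2 <= (5 / 4 * enorm v) ^+ 2.
  by rewrite lerXn2r ?nnegrE ?enorm_ge0// mulr_ge0 ?enorm_ge0.
nra.
Qed.

(** With [x = (2 n)^-1], the density [x^p] on a window of length [n / 2] contributes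
    [x^(p - 1) / 4]. This decreases in [n], so [n = 3 rho] is the worst case. *)
Lemma window_integral_const (R : realType) (p rho n : R) :
  1 < p -> 0 < n -> n <= 3 * rho ->
  4^-1 * ((6 * rho)^-1) `^ (p - 1) <= ((2 * n)^-1) `^ p * (n / 2).
Proof.
move=> p1 n0 nr.
have x0 : 0 < (2 * n)^-1 by rewrite invr_gt0 mulr_gt0.
rewrite -(mulr_powRB1 (ltW x0)); last by lra.
have -> : (2 * n)^-1 * (2 * n)^-1 `^ (p - 1) * (n / 2) =
          4^-1 * (2 * n)^-1 `^ (p - 1).
  by field; rewrite gt_eqF.
rewrite ler_wpM2l//; apply: ge0_ler_powR; rewrite ?nnegrE ?invr_ge0//; try lra.
by rewrite lef_pV2 ?posrE; lra.
Qed.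

Lemma between_dist (R : realType) (a0 a1 a : R) :
  Num.min a0 a1 <= a <= Num.max a0 a1 -> `|a - a0| <= `|a1 - a0|.
Proof.
case: (leP a0 a1) => a01 /andP[? ?].
  by rewrite !ger0_norm ?subr_ge0// lerD2r.
by rewrite !ler0_norm ?subr_le0 ?(ltW a01)// lerN2 lerD2r.
Qed.

(** Contacts are sought within [h] of [b0]; the radius [2 * h] leaves room for windows of
    half-length up to [3/4 h] around them. *)
Definition nearly_straight (R : realType) (d : nat) (L b0 h : R)
    (T : R -> 'rV[R]_d) (e : 'rV[R]_d) : Prop :=
  [/\ 0 < h, 0 <= b0 - 2 * h, b0 + 2 * h <= L, enorm e = 1 &
      forall b, b0 - 2 * h <= b <= b0 + 2 * h -> enorm (T b - e) <= 4^-1].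

Lemma nearly_straight_in (R : realType) (d : nat) (L b0 h b : R)
    (T : R -> 'rV[R]_d) (e : 'rV[R]_d) :
  nearly_straight L b0 h T e -> b0 - 2 * h <= b <= b0 + 2 * h ->
  b \in `[0, L].
Proof.
move=> [h0 hl hr _ _] /andP[bl br]; rewrite in_itv /=.
by rewrite (le_trans hl bl) (le_trans br hr).
Qed.

Lemma nearly_straight_exists (R : realType) (d : nat) (L b0 eta : R)
    (G T : R -> 'rV[R]_d) :
  unit_speed L G T -> 0 < b0 < L -> 0 < eta ->
  exists2 h, h < eta & nearly_straight L b0 h T (T b0).
Proof.
move=> [_ cT T1 _] /andP[b00 b0L] eta0.
have q0 : (0 : R) < 4^-1 by [].
have [eta1 eta10 heta1] := cT b0 _ q0.
pose h := Num.min (eta / 2) (Num.min (eta1 / 4) (Num.min (b0 / 2) ((L - b0) / 2))).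
have h0 : 0 < h by rewrite !lt_min !divr_gt0// subr_gt0.
(* Unfolding [h] on the right-hand side yields its four bounds at once. *)
have : h <= h by [].
rewrite {2}/h !le_min => /andP[h1 /and3P[h2 h3 h4]]; clearbody h.
exists h; first lra.
split => //; try lra.
move=> b /andP[bl br]; apply/ltW/heta1.
by rewrite ltr_norml; apply/andP; split; lra.
Qed.

Lemma nearly_straight_expand (R : realType) (d : nat) (L b0 h s t : R)
    (G T : R -> 'rV[R]_d) (e : 'rV[R]_d) :
  unit_speed L G T -> nearly_straight L b0 h T e ->
  b0 - h <= s -> s <= t -> t <= b0 + h -> (t - s) / 2 <= dotr (G t - G s) e.
Proof.
move=> us [h0 hl hr e1 Te] sl st tr; apply: (unit_speed_expand us) => //; try lra.
move=> u /andP[us' ut]; apply: (@le_trans _ _ 4^-1); last by lra.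
by apply: Te; apply/andP; split; lra.
Qed.

Lemma nearly_straight_dist (R : realType) (d : nat) (L b0 h s t : R)
    (G T : R -> 'rV[R]_d) (e : 'rV[R]_d) :
  unit_speed L G T -> nearly_straight L b0 h T e ->
  b0 - h <= s <= b0 + h -> b0 - h <= t <= b0 + h ->
  `|t - s| <= 2 * `|dotr (G t - G s) e|.
Proof.
move=> us ns; wlog st : s t / s <= t.
  move=> hw hs ht; case: (leP s t) => [st|/ltW ts]; first exact: hw.
  by have := hw t s ts ht hs; rewrite distrC -[G s - G t]opprB dotrNl normrN.
move=> /andP[sl _] /andP[_ tr]; rewrite ger0_norm ?subr_ge0//.
have := nearly_straight_expand us ns sl st tr.
have := ler_norm (dotr (G t - G s) e); lra.
Qed.

(** Along [e] the arc around [b0] has slope at least 1/2, so its [e]-coordinate takes all values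
    within [h / 2] of that of [G b0], in particular that of [G a]. Equal [e]-coordinates turn
    [|a - a2| <= rho] into [|b - b2| <= 2 * rho], and the common point [G a2 = G b2] gives
    [3 * rho]. *)
Lemma orthogonal_contact (R : realType) (d : nat) (L b0 h rho a a2 b2 : R)
    (G T : R -> 'rV[R]_d) (e : 'rV[R]_d) :
  unit_speed L G T -> nearly_straight L b0 h T e ->
  a \in `[0, L] -> enorm (G a - G b0) <= h / 2 ->
  a2 \in `[0, L] -> b0 - h <= b2 <= b0 + h -> G a2 = G b2 ->
  `|a - a2| <= rho ->
  exists2 b, b0 - h <= b <= b0 + h &
    dotr (G a - G b) e = 0 /\ enorm (G a - G b) <= 3 * rho.
Proof.
move=> us ns aD Gab0 a2D b2J Gb2 a2a.
have [cG _ _ _] := us; have [h0 hl hr e1 _] := ns.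
have Gd : `|dotr (G a - G b0) e| <= h / 2.
  by apply: (le_trans (abs_dotr_le _ _)); rewrite e1 mulr1.
have [b bJ Gb] : exists2 b, b0 - h <= b <= b0 + h & dotr (G b) e = dotr (G a) e.
  have hb : b0 - h <= b0 + h by clear -h0; lra.
  have [|b] := @IVT R (fun b => dotr (G b) e) _ _ (dotr (G a) e) hb
    (continuous_subspaceT (dotr_continuous cG)).
    have [bl br] : b0 - h <= b0 /\ b0 <= b0 + h by clear -h0; split; lra.
    have := nearly_straight_expand us ns bl br (lexx _).
    have := nearly_straight_expand us ns (lexx _) bl br.
    move: Gd; rewrite ge_min le_max ler_norml !dotrDl !dotrNl => /andP[].
    clear; set x := dotr _ _; set y := dotr _ _; set z := dotr _ _.
    move=> ? ? ? ?; apply/andP; split; apply/orP; [left|right]; lra.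
  by rewrite in_itv /=; exists b.
exists b => //; split; first by rewrite dotrDl dotrNl Gb subrr.
have bl : b0 - 2 * h <= b <= b0 + 2 * h.
  by move: bJ; clear -h0 => /andP[? ?]; apply/andP; split; lra.
have b2l : b0 - 2 * h <= b2 <= b0 + 2 * h.
  by move: b2J; clear -h0 => /andP[? ?]; apply/andP; split; lra.
have h1 := unit_speed_lipschitz us a2D aD.
have h2 := unit_speed_lipschitz us (nearly_straight_in ns bl)
  (nearly_straight_in ns b2l).
have h3 := nearly_straight_dist us ns b2J bJ.
have h4 : `|dotr (G b - G b2) e| <= rho.
  have -> : dotr (G b - G b2) e = dotr (G a - G a2) e.
    by rewrite !dotrDl !dotrNl Gb Gb2.
  apply: (le_trans (abs_dotr_le _ _)); rewrite e1 mulr1.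
  exact: le_trans a2a.
have := enorm_distD (G a2) (G a) (G b); rewrite {2}Gb2.
by move: h1 h2 h3 h4 a2a; rewrite (distrC b2); clear; lra.
Qed.

(** The circles pass through [G a] and are tangent to the nearly straight arc, where the tangent is
    controlled. The half-length [|G a - G b| / 4] of the window is the displacement that
    [transverse_tp_radius] allows. *)
Lemma contact_window (R : realType) (d : nat) (p L b0 h rho a b : R)
    (gamma G T : R -> 'rV[R]_d) (e : 'rV[R]_d) :
  2 < p -> unit_speed L G T ->
  {in `[0, L], gamma =1 G} -> {in `[0, L], derive_within `[0, L] gamma =1 T} ->
  nearly_straight L b0 h T e -> rho <= h ->
  a \in `[0, L] -> b0 - h <= b <= b0 + h -> G a != G b ->
  dotr (G a - G b) e = 0 -> enorm (G a - G b) <= 3 * rho ->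
  exists B c, [/\ measurable B, B `<=` `[0, L], (0 <= c)%E,
    (forall s, B s -> (c <= (rtp L gamma s a `^ p)^-1)%E) &
    ((4^-1 * ((6 * rho)^-1) `^ (p - 1))%:E <= c * @lebesgue_measure R B)%E].
Proof.
move=> p2 us gG gT ns rhoh aD bJ Gab ve v3; have [h0 hl hr e1 Te] := ns.
have [_ _ T1 _] := us.
set v := G a - G b in ve v3; have v0 : v != 0 by rewrite subr_eq0.
have v1 : 0 < enorm v by rewrite lt_def enorm_eq0 v0 enorm_ge0.
have p0 : 0 < p by clear -p2; lra.
have BD b' : b - enorm v / 4 <= b' <= b + enorm v / 4 ->
    b0 - 2 * h <= b' <= b0 + 2 * h.
  move: bJ v3 rhoh; clear -h0 => /andP[? ?] ? ? /andP[? ?].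
  by apply/andP; split; lra.
have bB : b - enorm v / 4 <= b <= b + enorm v / 4.
  by rewrite lerBlDr lerDl andbb divr_ge0// enorm_ge0.
have bD := nearly_straight_in ns (BD _ bB).
exists `[b - enorm v / 4, b + enorm v / 4]%classic, (((2 * enorm v)^-1) `^ p)%:E.
split.
- exact: measurable_itv.
- move=> b' /= b'B; apply: (nearly_straight_in ns); apply: BD.
  by rewrite in_itv in b'B.
- by rewrite lee_fin powR_ge0.
- move=> b'; rewrite /= !in_itv /= => b'B.
  have b'D := nearly_straight_in ns (BD _ b'B).
  have w1 : enorm (derive_within `[0, L] gamma b') = 1 by rewrite gT.
  apply: le_trans (rtp_ge a p0 w1); rewrite lee_fin gT// !gG//.
  apply: ge0_ler_powR; rewrite ?nnegrE ?(ltW p0)//.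
  + by rewrite invr_ge0 mulr_ge0 ?enorm_ge0.
  + by rewrite divr_ge0 ?mulr_ge0 ?exprn_ge0 ?enorm_ge0.
  have -> : G b' - G a = (G b' - G b) - v by rewrite opprB addrA subrK.
  apply: (@transverse_tp_radius _ _ _ _ e) => //; first exact/Te/BD.
  apply: (le_trans (unit_speed_lipschitz us bD b'D)).
  by move: b'B; clear => /andP[? ?]; rewrite ler_norml; apply/andP; split; lra.
- rewrite lebesgue_measure_itv /= lte_fin.
  have -> : b - enorm v / 4 < b + enorm v / 4 by clear -v1; lra.
  rewrite -EFinD -EFinM lee_fin.
  have -> : b + enorm v / 4 - (b - enorm v / 4) = enorm v / 2 by clear; lra.
  by apply: window_integral_const => //; clear -p2; lra.
Qed.

Lemma small_scale_blowup (R : realType) (p E rho0 : R) :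
  2 < p -> 0 < rho0 ->
  exists2 rho, 0 < rho <= rho0 & E < 4^-1 * ((6 * rho)^-1) `^ (p - 1) * rho.
Proof.
move=> p2 rho00; have p20 : 0 < p - 2 by lra.
(* With [rho = (6 * N)^-1] the quantity equals [N^(p - 2) / 24]; the first bound on [N] makes it
   exceed [E], the second ensures [rho <= rho0]. *)
pose N := Num.max ((24 * (`|E| + 1)) `^ (p - 2)^-1) (6 * rho0)^-1.
have hN : N <= N by [].
move: hN; rewrite {1}/N !ge_max => /andP[N1 N2].
have N0 : 0 < N by apply: lt_le_trans N2; rewrite invr_gt0 mulr_gt0.
have rE : (6 * (6 * N)^-1)^-1 = N by field; rewrite gt_eqF.
exists (6 * N)^-1.
  rewrite invr_gt0 mulr_gt0//= -div1r ler_pdivrMr ?mulr_gt0//.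
  by move: N2; rewrite -div1r ler_pdivrMr ?mulr_gt0//; lra.
rewrite rE.
have -> : 4^-1 * N `^ (p - 1) * (6 * N)^-1 = N `^ (p - 2) / 24.
  rewrite -(mulr_powRB1 (ltW N0) (_ : 0 < p - 1)); last by lra.
  rewrite (_ : p - 1 - 1 = p - 2); last by ring.
  by field; rewrite gt_eqF.
have : 24 * (`|E| + 1) <= N `^ (p - 2).
  have E24 : 0 <= 24 * (`|E| + 1) by rewrite mulr_ge0// addr_ge0.
  have -> : 24 * (`|E| + 1) = ((24 * (`|E| + 1)) `^ (p - 2)^-1) `^ (p - 2).
    by rewrite -powRrM mulVf ?powRr1// gt_eqF.
  by apply: ge0_ler_powR; rewrite ?nnegrE ?powR_ge0 ?(ltW p20) ?(ltW N0).
have := ler_norm E; lra.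
Qed.

(* The interior parameter is [b0] only: [a0] may be an endpoint, in which case
   its one-sided arc is absorbed by the arc around [b0]. *)
Definition arcs_coincide (R : realType) (d : nat) (L : R)
    (G : R -> 'rV[R]_d) : Prop :=
  forall a0 b0, a0 \in `[0, L] -> 0 < b0 < L -> G a0 = G b0 ->
  forall eta : R, 0 < eta -> exists2 r : R, 0 < r &
  forall a, a \in `[0, L] -> `|a - a0| < r ->
    exists2 b, `|b - b0| < eta & G a = G b.

(* If the arc near [a0] leaves the arc near [b0] at [a2], then at distance
   [<= rho] from [a2] the two arcs are [3 rho]-close but disjoint, and the
   resulting contribution to the energy is of order [rho ^ (2 - p)]. *)
Lemma local_coincidence (R : realType) (d : nat) (p L E : R)
    (gamma : R -> 'rV[R]_d) (G T : R -> 'rV[R]_d) :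
  2 < p -> unit_speed L G T -> arclength_param L gamma ->
  {in `[0, L], gamma =1 G} -> {in `[0, L], derive_within `[0, L] gamma =1 T} ->
  (Etp p L gamma <= E%:E)%E -> arcs_coincide L G.
Proof.
move=> p2 us gu gG gT hE a0 b0 a0D b0D Gab eta eta0.
have [cG _ _ _] := us.
have [h hh ns] := nearly_straight_exists us b0D eta0.
have [h0 hl hr e1 Te] := ns.
pose J := `[b0 - h, b0 + h]%classic.
(* The parameters whose image lies on the arc around [b0]; this arc is compact, so the set is
   closed, as [exit_point] requires. *)
pose Z := G @^-1` (G @` J).
have contG : continuous G := enorm_continuous cG.
have cZ : closed Z.
  apply: preimage_closed => //; apply: compact_closed; first exact: norm_hausdorff.
  apply: continuous_compact; last exact: segment_compact.
  exact: continuous_subspaceT.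
(* Unit speed turns this radius into the bound [h / 2] on [|G a - G b0|], the reach of the arc in
   direction [e]. *)
exists (h / 2); first by rewrite divr_gt0.
move=> a1 a1D a1a0.
have [[b]|nZ] := pselect (Z a1).
  rewrite /J /= in_itv /= => /andP[bl br] Gb; exists b => //.
  by rewrite ltr_norml; apply/andP; split; lra.
exfalso.
have Za0 : Z a0.
  by exists b0 => //; rewrite /J /= in_itv /= lerBlDr lerDl andbb ltW.
have [a2 [[b2 b2J Gb2] a2I] [rho0 rho00 hrho]] := exit_point cZ Za0 nZ.
rewrite /J /= in_itv /= in b2J.
have inD a : Num.min a0 a1 <= a <= Num.max a0 a1 -> a \in `[0, L].
  move: a0D a1D; rewrite !in_itv /= => /andP[p1 q1] /andP[p2' q2] /andP[am aM].
  apply/andP; split.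
    by apply: le_trans am; rewrite le_min p1.
  by apply: le_trans aM _; rewrite ge_max q1.
have [|rho /andP[rp]] := small_scale_blowup E p2 (_ : 0 < Num.min rho0 h).
  by rewrite lt_min rho00.
rewrite le_min => /andP[rho1 rhoh]; apply/negP; rewrite -leNgt.
have [|A [mA lA hA]] := hrho rho; first by rewrite rp.
rewrite -lee_fin; apply: le_trans hE.
rewrite (EtpE p gu) EFinM -lA.
apply: (@ge_cst_integral2 R _ _ (@lebesgue_measure R) `[0, L]%classic A
  (fun t s => (rtp L gamma s t `^ p)^-1)%E) => //.
- by move=> a /hA[/inD].
- by rewrite lee_fin mulr_ge0// powR_ge0.
- by move=> t s; exact: rtp_powV_ge0.
move=> a Aa; have [aI nZa a2a] := hA a Aa.
have aD := inD _ aI.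
have Gab0 : enorm (G a - G b0) <= h / 2.
  rewrite -Gab; apply: le_trans (unit_speed_lipschitz us a0D aD) _.
  by apply/ltW/(le_lt_trans _ a1a0)/between_dist.
have [b bJ [ve v3]] :=
  orthogonal_contact us ns aD Gab0 (inD _ a2I) b2J (esym Gb2) a2a.
apply: (contact_window p2 us gG gT ns rhoh aD bJ _ ve v3).
by apply: contra_notN nZa => /eqP Gba; exists b; rewrite /J /= ?in_itv.
Qed.

(** * Charts *)

Lemma C1_on_of_has_derive (R : realType) (d : nat) (O : set R)
    (psi S : R -> 'rV[R]_d) :
  econtinuous S ->
  (forall t, O t -> limit_point_of O t) ->
  (forall t, O t -> has_derive_within O psi t (S t)) ->
  (forall t, S t != 0) ->
  C1_on O psi /\ (forall t, O t -> derive_within O psi t != 0).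
Proof.
move=> cS lO dO S0.
have dE t : O t -> derivable_within O psi t /\ derive_within O psi t = S t.
  by move=> Ot; apply: has_derive_within_val; [exact: lO|exact: dO].
split; last by move=> t /dE[_ ->].
split; first by move=> t /dE[].
apply/subspace_continuousP => t Ot; apply/near_enormP => e e0.
apply/within_nearP; have [r r0 h] := cS t e e0.
exists r => // u Ou /h hu.
rewrite /from_subspace (proj2 (dE t Ot)) (proj2 (dE u Ou)).
exact: hu.
Qed.

Definition chart_at (R : realType) (d : nat) (E : set 'rV[R]_d)
    (x : 'rV[R]_d) : Prop :=
  exists2 W : set 'rV[R]_d, open W /\ W x &
  exists (O : set R) (psi : R -> 'rV[R]_d) (phi : 'rV[R]_d -> R),
    [/\ open_in_halfline O,
        C1_on O psi /\ (forall t, O t -> derive_within O psi t != 0),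
        set_bij O (E `&` W) psi,
        (forall t, O t -> phi (psi t) = t) &
        {within E `&` W, continuous phi}].

(** Expansion makes [psi] injective with a 2-Lipschitz inverse for the Euclidean norm. [W] is the
    complement of the image of [K], the compact set of parameters near which the curve does not stay
    in the image of [O]; by the openness hypothesis no such parameter is sent into that image, so
    further passages through the same points do no harm. *)
Lemma chart_of_expanding (R : realType) (d : nat) (L : R) (O : set R)
    (G psi : R -> 'rV[R]_d) (x : 'rV[R]_d) :
  econtinuous G ->
  open_in_halfline O ->
  C1_on O psi /\ (forall t, O t -> derive_within O psi t != 0) ->
  (forall s t, O s -> O t -> `|t - s| <= 2 * enorm (psi t - psi s)) ->
  (forall u, O u -> exists2 t, t \in `[0, L] & psi u = G t) ->
  (forall t u, t \in `[0, L] -> O u -> G t = psi u ->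
     exists2 r : R, 0 < r & forall a, a \in `[0, L] -> `|a - t| < r ->
       exists2 v, O v & G a = psi v) ->
  (exists2 u, O u & x = psi u) ->
  chart_at (G @` `[0, L]) x.
Proof.
move=> cG oO c1 ex im op [u0 Ou0 xu0].
pose V := [set a : R | exists2 r : R, 0 < r & forall b, b \in `[0, L] ->
  `|b - a| < r -> exists2 v, O v & G b = psi v].
have oV : open V.
  rewrite openE => a [r r0 hr]; apply/nbhs_ballP; exists (r / 2) => /=.
    by rewrite divr_gt0.
  move=> b; rewrite /ball /= => ab; exists (r / 2); first by rewrite divr_gt0.
  move=> c cD cb; apply: hr => //.
  by have := ler_distD b c a; rewrite (distrC b a); lra.
pose K := `[0, L]%classic `&` ~` V.
have cK : compact K.
  by apply: compact_closedI; [exact: segment_compact|exact: open_closedC].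
have cGK : closed (G @` K).
  apply: compact_closed; first exact: norm_hausdorff.
  apply: continuous_compact => //; apply: continuous_subspaceT.
  exact: enorm_continuous.
have inj : {in O &, injective psi}.
  move=> s t; rewrite !inE => Os Ot e; apply/eqP; rewrite eq_sym -subr_eq0.
  by rewrite -normr_le0 (le_trans (ex _ _ Os Ot))// e subrr enorm0 mulr0.
have OW u : O u -> (~` (G @` K)) (psi u).
  move=> Ou [t [tD nV] Gt]; apply: nV.
  by have [r r0 hr] := op t u tD Ou Gt; exists r.
exists (~` (G @` K)); first by split; [exact: closed_openC|rewrite xu0; exact: OW].
exists O, psi, (fun y => xget 0 [set u | O u /\ psi u = y]).
have phiE t : O t -> xget 0 [set u | O u /\ psi u = psi t] = t.
  move=> Ot; have [Ou e] := xgetI 0 (conj Ot (erefl (psi t)) :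
     [set u | O u /\ psi u = psi t] t).
  by apply: inj; rewrite ?inE.
have sur y : (G @` `[0, L] `&` ~` (G @` K)) y -> exists2 u, O u & psi u = y.
  move=> [[t tD Gt] nK].
  have [Vt|nVt] := pselect (V t).
    have [r r0 hr] := Vt; have [|v Ov Gv] := hr t tD.
      by rewrite subrr normr0.
    by exists v => //; rewrite -Gv.
  by exfalso; apply: nK; exists t.
split => //.
- split.
  + move=> u Ou; split; last exact: OW.
    by have [t tD ->] := im u Ou; exists t.
  + exact: inj.
  + by move=> y /sur[u Ou uy]; exists u.
- apply/subspace_continuousP => y /sur[u Ou <-].
  apply/cvgrPdist_lt => e e0; rewrite near_withinE.
  have d0 : 0 < d.+1%:R :> R by rewrite ltr0n.
  have r0 : 0 < e / (2 * d.+1%:R) by rewrite divr_gt0// mulr_gt0.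
  have hn : \forall z \near nbhs (psi u), `|psi u - z| < e / (2 * d.+1%:R).
    exact: cvgr_dist_lt r0.
  apply: filterS hn => z hz /sur[v Ov vz]; rewrite -vz /from_subspace !phiE//.
  apply: (le_lt_trans (ex _ _ Ov Ou)); rewrite vz.
  have := enorm_le_norm (psi u - z); move: hz => /=.
  rewrite ltr_pdivlMr ?mulr_gt0// => hz hd.
  have : d%:R * `|psi u - z| <= d.+1%:R * `|psi u - z| by rewrite ler_wpM2r// ler_nat.
  lra.
Qed.

Lemma limit_point_itv (R : realType) (O : set R) (a b : R) :
  `]a, b[ `<=` O -> forall t, a <= t < b -> limit_point_of O t.
Proof.
move=> abO t /andP[at' tb] r r0.
set m := Num.min r (b - t).
have m0 : 0 < m by rewrite lt_min r0 subr_gt0.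
have [mr mb] : m <= r /\ m <= b - t by split; rewrite ge_min lexx ?orbT.
pose q := m / 2.
have q0 : 0 < q by rewrite divr_gt0.
have qr : q < r /\ q < b - t by rewrite /q; split; lra.
exists (t + q); split.
- by apply: abO; rewrite /= in_itv /=; case: qr => _ ?; apply/andP; split; lra.
- by rewrite -subr_eq0 addrC addKr gt_eqF.
- by rewrite addrC addKr gtr0_norm//; case: qr.
Qed.

Lemma unit_neq0 (R : realType) (d : nat) (v : 'rV[R]_d) :
  enorm v = 1 -> v != 0.
Proof. by move=> v1; rewrite -enorm_eq0 v1 oner_eq0. Qed.

(** The margin in [nearly_straight] places the interval inside []0, +oo[], so [G] itself serves as
    the chart. *)
Lemma interior_chart (R : realType) (d : nat) (L b0 : R)
    (G T : R -> 'rV[R]_d) :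
  unit_speed L G T -> 0 < b0 < L ->
  arcs_coincide L G ->
  chart_at (G @` `[0, L]) (G b0).
Proof.
move=> us b0L lc; have [cG cT T1 dG] := us.
have [h _ ns] := nearly_straight_exists us b0L ltr01.
have [h0 hl hr e1 Te] := ns.
have OD u : `]b0 - h, b0 + h[%classic u -> u \in `[0, L].
  rewrite /= !in_itv /= => /andP[? ?]; apply: (nearly_straight_in ns).
  by apply/andP; split; lra.
apply: (@chart_of_expanding _ _ L `]b0 - h, b0 + h[%classic G G) => //.
- exists `]b0 - h, b0 + h[%classic; first exact: itv_open.
  apply/seteqP; split => [u uO|u [] //]; split => //=.
  by rewrite in_itv /= andbT; move: (OD u uO); rewrite in_itv => /andP[].
- apply: (@C1_on_of_has_derive _ _ _ _ T) => //.
  + move=> t tO; apply: limit_point_itv (@subset_refl _ _) _ _.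
    by move: tO; rewrite /= in_itv /= => /andP[/ltW -> ->].
  + by move=> t tO; apply: has_derive_within_sub (dG t (OD t tO)) => u /OD.
  + by move=> t; exact: unit_neq0.
- move=> s t; rewrite /= !in_itv /= => /andP[/ltW s1 /ltW s2] /andP[/ltW t1 /ltW t2].
  have := @nearly_straight_dist _ _ _ _ _ s t _ _ _ us ns.
  rewrite s1 s2 t1 t2 => /(_ isT isT) /le_trans; apply.
  rewrite ler_wpM2l//; apply: le_trans (abs_dotr_le _ _) _.
  by rewrite e1 mulr1.
- by move=> u /OD uD; exists u.
- move=> t u tD uO Gtu; move: (uO); rewrite /= in_itv /= => /andP[ul ur].
  have uL : 0 < u < L by apply/andP; split; lra.
  (* The distance from [u] to the ends of the interval, so that matching parameters stay in it. *)
  have eta0 : 0 < Num.min (u - (b0 - h)) (b0 + h - u).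
    by rewrite lt_min !subr_gt0 ul.
  have [r r0 hr'] := lc t u tD uL Gtu _ eta0.
  exists r => // a aD /(hr' a aD)[b hb Gb]; exists b => //.
  move: hb; rewrite lt_min !ltr_norml /= in_itv /= => /andP[/andP[? ?] /andP[? ?]].
  by apply/andP; split; lra.
- exists b0 => //=; rewrite in_itv /= ltrBlDr ltrDl h0 //.
Qed.

(** [sg] stands for the identity or for [t |-> L - t], and brings either end to parameter 0, where
    [[0, h[] is relatively open in the half-line. *)
Lemma end_chart (R : realType) (d : nat) (L : R) (sg : R -> R)
    (G S : R -> 'rV[R]_d) :
  0 < L ->
  econtinuous G ->
  involutive sg -> (forall s t, `|sg s - sg t| = `|s - t|) ->
  (forall t, t \in `[0, L] -> sg t \in `[0, L]) ->
  (forall t, 0 < t < L -> 0 < sg t < L) ->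
  unit_speed L (G \o sg) S ->
  (forall t, t \in `[0, L] -> G t = G (sg 0) -> t = sg 0) ->
  arcs_coincide L G ->
  chart_at (G @` `[0, L]) (G (sg 0)).
Proof.
move=> L0 cG sgK sgD sgI sgi us uq lc; have [_ cS S1 dG] := us.
have [r r0 hr] := cS 0 1 ltr01.
pose h := Num.min r L; have h0 : 0 < h by rewrite lt_min r0.
have [hr' hL] : h <= r /\ h <= L by split; rewrite ge_min lexx ?orbT.
have OD u : `[0, h[%classic u -> u \in `[0, L].
  by rewrite /= !in_itv /= => /andP[-> /ltW /le_trans]; apply.
apply: (@chart_of_expanding _ _ L `[0, h[%classic G (G \o sg)) => //.
- exists `]-h, h[%classic; first exact: itv_open.
  apply/seteqP; split => u; rewrite /= !in_itv /=.
    by move=> /andP[u0 uh]; rewrite u0 uh; split => //; rewrite andbT; lra.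
  by move=> [/andP[_ ->]]; rewrite andbT => ->.
- apply: (@C1_on_of_has_derive _ _ _ _ S) => //.
  + move=> t; rewrite /= in_itv /=; apply: limit_point_itv => u.
    by rewrite /= !in_itv /= => /andP[/ltW -> ->].
  + by move=> t tO; apply: has_derive_within_sub (dG t (OD t tO)) => u /OD.
  + by move=> t; exact: unit_neq0.
- move=> s t; wlog st : s t / s <= t.
    move=> hw sO tO; case: (leP s t) => [st|/ltW ts]; first exact: hw.
    by rewrite distrC enormBC; exact: hw.
  rewrite /= !in_itv /= => /andP[s0 _] /andP[_ th].
  rewrite ger0_norm ?subr_ge0//.
  apply: (unit_speed_expand_norm us s0 st _ (S1 0)); first by lra.
  move=> u /andP[su ut]; apply/ltW/hr; rewrite subr0 ger0_norm; lra.
- by move=> u /OD uD; exists (sg u) => //; exact: sgI.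
- move=> t u tD uO Gtu; move: (uO); rewrite /= in_itv /= => /andP[].
  rewrite le_eqVlt => /predU1P[u0 _|u0 uh].
    (* Coincidence of arcs requires an interior parameter, so at [u = 0] uniqueness of the preimage
       of the end takes over. *)
    have tE : t = sg 0 by apply: uq => //; rewrite u0.
    exists h => // a aD; rewrite tE => ah; exists (sg a); last by rewrite /= sgK.
    have aD' := sgI _ aD.
    have := sgD (sg a) 0; rewrite sgK subr0 => ha; rewrite ha in ah.
    move: aD' ah; rewrite /= !in_itv /= => /andP[a0 _].
    by rewrite a0 ger0_norm.
  have uL : 0 < sg u < L by apply: sgi; rewrite u0; lra.
  have eta0 : 0 < Num.min u (h - u) by rewrite lt_min u0 subr_gt0.
  have [q q0 hq] := lc t (sg u) tD uL Gtu _ eta0.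
  exists q => // a aD /(hq a aD)[b hb Gb].
  exists (sg b); last by rewrite /= sgK.
  move: hb; rewrite -[b in `|b - _|]sgK sgD lt_min !ltr_norml /= in_itv /=.
  by move=> /andP[/andP[? ?] /andP[? ?]]; apply/andP; split; lra.
- by exists 0 => //=; rewrite in_itv /= lexx.
Qed.

Lemma unit_speed_rev (R : realType) (d : nat) (L : R) (G T : R -> 'rV[R]_d) :
  unit_speed L G T ->
  unit_speed L (G \o (fun t => L - t)) (fun t => - T (L - t)).
Proof.
move=> [cG cT T1 dG].
have dist s t : `|L - s - (L - t)| = `|s - t|.
  by rewrite opprB addrC addrA subrK distrC.
split.
- move=> t e /(cG (L - t))[r r0 h]; exists r => // u ut.
  by apply: h; rewrite dist.
- move=> t e /(cT (L - t))[r r0 h]; exists r => // u ut.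
  by rewrite -opprD enormN; apply: h; rewrite dist.
- by move=> t; rewrite enormN.
move=> t tD e e0.
have rD u : u \in `[0, L] -> L - u \in `[0, L].
  by rewrite !in_itv /= => /andP[? ?]; apply/andP; split; lra.
have [r r0 h] := dG _ (rD _ tD) e e0; exists r => // u uD ut utr.
have := h (L - u) (rD _ uD); rewrite dist => /(_ _ utr) H.
rewrite -enormN opprB addrC /=.
have -> : - difference_quotient (G \o (fun t => L - t)) t u + - T (L - t) =
          difference_quotient G (L - t) (L - u) - T (L - t).
  rewrite /difference_quotient /= -scaleNr; congr (_ *: _ - _).
  by rewrite -invrN; congr (_^-1); ring.
by apply: H; apply: contra_neq ut => ?; lra.
Qed.

(** A point hit by an interior parameter gets an interior chart even if it is also the image of an
    end. Any other point is the image of exactly one end because [G 0 != G L], and [end_chart]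
    relies on this uniqueness. *)
Lemma embedded_image (R : realType) (d : nat) (L : R)
    (G T : R -> 'rV[R]_d) :
  0 < L -> unit_speed L G T -> G 0 != G L ->
  arcs_coincide L G ->
  embedded_curve_with_boundary (G @` `[0, L]).
Proof.
move=> L0 us G0L lc x [t tD Gt]; have [cG _ _ _] := us.
have [[u uL Gu]|ni] := pselect (exists2 u, 0 < u < L & G u = x).
  by rewrite -Gu; exact: interior_chart us uL lc.
have uq a b : a \in `[0, L] -> b = 0 \/ b = L -> G b = x -> G a = G b -> a = b.
  move=> + bE Gb Gab; rewrite in_itv /= => /andP[a0 aL].
  have [a00|a00] := eqVneq a 0.
    case: bE => bE; first by rewrite a00.
    by move: G0L; rewrite -a00 -bE Gab eqxx.
  have [aLL|aLL] := eqVneq a L.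
    case: bE => bE; last by rewrite aLL.
    by move: G0L; rewrite -aLL -bE Gab eqxx.
  exfalso; apply: ni; exists a; last by rewrite Gab.
  by rewrite !lt_neqAle eq_sym a00 a0 aLL aL.
have tE : t = 0 \/ t = L.
  move: tD; rewrite /= in_itv /= => /andP[t0 tL].
  have [t00|t00] := eqVneq t 0; first by left.
  have [tLL|tLL] := eqVneq t L; first by right.
  exfalso; apply: ni; exists t => //.
  by rewrite !lt_neqAle eq_sym t00 t0 tLL tL.
case: tE => tE; rewrite -Gt tE.
- apply: (@end_chart _ _ L id G T) => //.
  by move=> a aD Ga; apply: uq => //; [left|rewrite -Gt tE].
- rewrite -[in G L](subr0 L).
  apply: (@end_chart _ _ L (fun t => L - t) G (fun t => - T (L - t))) => //.
  + by move=> a; rewrite opprB addrC subrK.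
  + by move=> a b; rewrite opprB addrC addrA subrK distrC.
  + by move=> a; rewrite !in_itv /= => /andP[? ?]; apply/andP; split; lra.
  + by move=> a /andP[? ?]; apply/andP; split; lra.
  + exact: unit_speed_rev.
  + by move=> a aD; rewrite subr0 => Ga; apply: uq => //; [right|rewrite -Gt tE].
Qed.

(** * Sobolev regularity *)

Lemma Lp_on_continuous (R : realType) (p a b : R) (f F : R -> R) :
  0 < p -> a <= b -> continuous F -> {in `[a, b], f =1 F} -> Lp_on p a b f.
Proof.
move=> p0 ab cF fF.
have fE : f \_ `[a, b] = F \_ `[a, b].
  apply/funext => x; rewrite !patchE; case: ifPn => // xab.
  rewrite inE in xab; by rewrite fF.
rewrite /Lp_on fE.
have mF : measurable_fun setT (F \_ `[a, b]).
  apply: (measurable_restrictT _ _).1; first exact: measurable_itv.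
  exact: measurable_funTS (continuous_measurable_fun cF).
apply/andP; split; rewrite !inE//= /finite_norm.
rewrite unlock /Lnorm; apply: poweR_lty.
have [m _ hm] := @EVT_max R (fun x => `|F x|) a b ab
  (continuous_subspaceT (fun x => continuous_comp (cF x) (@norm_continuous _ _ _))).
apply: (@le_lt_trans _ _ (\int[@lebesgue_measure R]_x
    ((cst (`|F m| `^ p)%:E) \_ `[a, b]) x)%E).
  apply: ge0_le_integral_nomeas => x _; first by rewrite lee_fin powR_ge0.
  rewrite /= !patchE; case: ifPn => xab.
    rewrite lee_fin; apply: ge0_ler_powR; rewrite ?nnegrE ?(ltW p0)//.
    by apply: hm; rewrite inE in xab.
  by rewrite normr0 powR0// gt_eqF.
rewrite -integral_mkcond integral_cst//= lebesgue_measure_itv /=.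
case: ifP => _; last by rewrite mule0.
by rewrite -EFinD -EFinM ltry.
Qed.

Lemma test_function_ends (R : realType) (a b : R) (phi : R -> R) :
  test_function a b phi -> phi a = 0 /\ phi b = 0.
Proof.
move=> [_ _ h].
have vanish x : x = a \/ x = b -> phi x = 0.
  move=> xab; apply/eqP; apply: contrapT => /negP px.
  have := h x (@subset_closure _ _ x px).
  by rewrite /= in_itv /=; case: xab => ->; rewrite ltxx ?andbF.
by split; apply: vanish; [left|right].
Qed.

(** Integration by parts; the boundary terms vanish because the closed support of a test function
    misses [a] and [b]. *)
Lemma weak_derivative_of_is_derive (R : realType) (a b : R) (f g F dF : R -> R) :
  a < b -> continuous F -> continuous dF ->
  (forall x, x \in `]a, b[ -> is_derive x 1 F (dF x)) ->
  {in `[a, b], f =1 F} -> {in `[a, b], g =1 dF} -> weak_derivative a b f g.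
Proof.
move=> ab cF cdF hF fF gdF phi tphi.
have [pa pb] := test_function_ends tphi.
have [dphi _ _] := tphi.
have cphi : continuous phi.
  by move=> x; apply/differentiable_continuous/derivable1_diffP; exact: (dphi 0%N).
have cdphi : continuous (derive1 phi).
  move=> x; apply/differentiable_continuous/derivable1_diffP.
  by have := dphi 1%N x; rewrite derive1n1.
have LR (h : R -> R) : continuous h -> {in `]a, b[, forall x, derivable h x 1} ->
    derivable_oo_LRcontinuous h a b.
  move=> ch dh; split => //.
    by apply: cvg_at_right_filter; exact: ch.
  by apply: cvg_at_left_filter; exact: ch.
have hFd x : x \in `]a, b[ -> derivable F x 1 by move=> /hF[].
have hFv : {in `]a, b[, derive1 F =1 dF}.
  by move=> x /hF[_ <-]; rewrite derive1E.
have := @Rintegration_by_parts R F phi dF (derive1 phi) a b ab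
  (continuous_subspaceT cdF) (LR F cF hFd) hFv (continuous_subspaceT cdphi)
  (LR phi cphi (fun x _ => dphi 0%N x)) (fun x _ => erefl).
rewrite pa pb !mulr0 subrr sub0r.
have -> : \int[lebesgue_measure]_(x in `[a, b]) (F x * derive1 phi x) =
          \int[lebesgue_measure]_(x in `[a, b]) (f x * derive1 phi x).
  by apply: eq_Rintegral => x; rewrite inE => xab; rewrite fF.
move=> ->; congr (- _).
by apply: eq_Rintegral => x; rewrite inE => xab; rewrite gdF.
Qed.

(** Presents a coordinate as an inner product, so that [is_derive_dotr] differentiates it. *)
Lemma dotr_delta (R : realType) (d : nat) (v : 'rV[R]_d) (i : 'I_d) :
  dotr v (delta_mx ord0 i) = v ord0 i.
Proof.
rewrite /dotr (bigD1 i)//= mxE !eqxx mulr1 big1 ?addr0// => j ji.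
by rewrite mxE eqxx (negbTE ji) mulr0.
Qed.

(** The weak derivative is the classical tangent, coordinate by coordinate, and the seminorm of a
    coordinate is at most that of the vector. *)
Lemma in_W1_vec_curve (R : realType) (d : nat) (p L : R)
    (gamma G T : R -> 'rV[R]_d) :
  0 < p -> 0 < L -> unit_speed L G T ->
  {in `[0, L], gamma =1 G} -> {in `[0, L], derive_within `[0, L] gamma =1 T} ->
  (slobodeckij_pow (@enorm R d) (1 - p^-1) p 0 L
     (derive_within `[0%R, L] gamma) < +oo)%E ->
  in_W1_vec (1 - p^-1) p 0 L gamma.
Proof.
move=> p0 L0 [cG cT T1 dG] gG gT hS i.
exists (fun t => derive_within `[0, L] gamma t ord0 i); split.
- apply: (@Lp_on_continuous _ _ _ _ _ (fun t => G t ord0 i) p0 (ltW L0)).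
    exact: continuous_coord.
  by move=> t tD; rewrite gG.
- apply: (@weak_derivative_of_is_derive _ _ _ _ _ (fun t => G t ord0 i)
    (fun t => T t ord0 i) L0).
  + exact: continuous_coord.
  + exact: continuous_coord.
  + move=> t tD.
    have tD' : t \in `[0, L] by apply: subset_itv_oo_cc tD.
    have := is_derive_dotr (delta_mx ord0 i) tD (dG t tD').
    by rewrite dotr_delta; under eq_fun do rewrite dotr_delta.
  + by move=> t tD; rewrite gG.
  + by move=> t tD; rewrite gT.
- apply: (@Lp_on_continuous _ _ _ _ _ (fun t => T t ord0 i) p0 (ltW L0)).
    exact: continuous_coord.
  by move=> t tD; rewrite gT.
- apply: le_lt_trans hS; apply: ge0_le_integral_nomeas => t _.
    by apply: integral_ge0 => s _; rewrite lee_fin divr_ge0 ?powR_ge0.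
  apply: ge0_le_integral_nomeas => s _; first by rewrite lee_fin divr_ge0 ?powR_ge0.
  rewrite lee_fin ler_wpM2r ?invr_ge0 ?powR_ge0//.
  apply: ge0_ler_powR; rewrite ?nnegrE ?(ltW p0) ?enorm_ge0//.
  have := abs_coord_le_enorm
    (derive_within `[0, L] gamma s - derive_within `[0, L] gamma t) i.
  by rewrite !mxE.
Qed.

(** * Assembly of the three conclusions *)

Lemma slobodeckij_bound_gt0 (R : realType) (p M : R) :
  2 < p -> 0 < M -> 0 < slobodeckij_bound p M.
Proof.
move=> p2 M0; apply: ltr_pwDl; first by rewrite !mulr_gt0 ?powR_gt0.
by rewrite mulr_ge0 ?powR_ge0 ?sqr_ge0.
Qed.

Theorem proposition4p5 (R : realType) (p M : R) (hp : 2 < p) (hM : 0 < M) :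
  exists2 C : R, 0 < C &
  forall (d : nat) (L : R) (gamma : R -> 'rV[R]_d),
    0 < L ->
    C1_on `[0, L] gamma ->
    arclength_param L gamma ->
    (energyR p L gamma <= M%:E)%E ->
    [/\ in_W1_vec (1 - p^-1) p 0 L gamma,
        embedded_curve_with_boundary (gamma @` `[0, L]) &
        (slobodeckij_pow (@enorm R d) (1 - p^-1) p 0 L
           (derive_within `[0%R, L] gamma) <= C%:E)%E].
Proof.
exists (slobodeckij_bound p M); first exact: slobodeckij_bound_gt0.
move=> d L gamma L0 gC1 gu gM.
have us := C1_on_unit_speed L0 gC1 gu.
set G := gamma \o clamp L in us; set T := _ \o clamp L in us.
have gG : {in `[0, L], gamma =1 G} by move=> t tD; rewrite /G /= clamp_id.
have gT : {in `[0, L], derive_within `[0, L] gamma =1 T}.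
  by move=> t tD; rewrite /T /= clamp_id.
have p0 : 0 < p by lra.
have [EM LM g0L] := energyR_bounds L0 gu us gG gM.
have hS : (slobodeckij_pow (@enorm R d) (1 - p^-1) p 0 L
           (derive_within `[0%R, L] gamma) <= (slobodeckij_bound p M)%:E)%E.
  apply: (slobodeckij_pow_le hp hM L0 LM us gT).
  apply: le_trans (integral_tp_sym_le gu us gG gT p0) _.
  by rewrite EFinM lee_wpmul2l.
split => //.
  apply: (in_W1_vec_curve p0 L0 us gG gT).
  exact: le_lt_trans hS (ltry _).
have -> : gamma @` `[0, L] = G @` `[0, L].
  by apply: eq_imagel => t tD; rewrite gG.
apply: (embedded_image L0 us).
  by rewrite -!gG// in_itv /= lexx ltW.
exact: (local_coincidence hp us gu gG gT EM).
Qed.
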